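(* Let $(\eta^j)_{j\ge1}$ be a family of $n$-forms on an $n$-plectic manifold $(M,\omega)$. Let $(E=E_{-n}\oplus\cdots\oplus E_{-1},\ \mu=l_1+\cdots+l_{n+1})$ be the Lie $n$-algebra associated to $(M,\omega)$. For each $j$ and each $2\le i\le n$ define the vector valued $i$-form $\widetilde{\eta^j_i}$ on $E$ by $$\widetilde{\eta^j_i}(\beta_1,\dots,\beta_i)=\begin{cases}\iota_{\chi_{\beta_1}}\cdots\iota_{\chi_{\beta_i}}\eta^j,&\text{if }\beta_k\in E_{-1}\text{ for all }1\le k\le i,\\0,&\text{otherwise (homogeneous arguments)},\end{cases}$$ where $\chi_{\beta_1},\dots,\chi_{\beta_i}$ are the unique Hamiltonian vector fields associated to the Hamiltonian forms $\beta_1,\dots,\beta_i$. Then $\mathcal N:=S+\sum_{j\ge1}\sum_{i=2}^{n}\widetilde{\eta^j_i}$, with $S$ the Euler map, is a Nijenhuis vector valued form with respect to the Lie $n$-algebra structure $\mu=l_1+\cdots+l_{n+1}$ associated to the $n$-plectic manifold $(M,\omega)$.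
   Context: $n$-plectic manifold: a manifold $M$ with a closed $(n+1)$-form $\omega$ that is non-degenerate ($\iota_X\omega=0$ implies $X=0$). An $(n-1)$-form $\alpha$ is Hamiltonian if there is a (necessarily unique) vector field $\chi_\alpha$, its Hamiltonian vector field, with $\mathrm d\alpha=-\iota_{\chi_\alpha}\omega$; $\Omega^{n-1}_{Ham}(M)$ denotes the space of these. On a graded vector space $E$, a symmetric vector valued $k$-form is a graded symmetric $k$-linear map $K:E^{k}\to E$ (exchanging adjacent arguments $X,Y$ gives the sign $(-1)^{|X||Y|}$), of degree $\bar K$ if $|K(X_1,\dots,X_k)|=|X_1|+\dots+|X_k|+\bar K$. For a $k$-form $K$ and $l$-form $L$, $$\iota_KL(X_1,\dots,X_{k+l-1})=\sum_{\sigma\in Sh(k,l-1)}\epsilon(\sigma)L(K(X_{\sigma(1)},\dots,X_{\sigma(k)}),X_{\sigma(k+1)},\dots,X_{\sigma(k+l-1)}),$$ with $Sh(k,l-1)$ the $(k,l-1)$-unshuffles and $\epsilon(\sigma)$ the Koszul sign. The Richardson–Nijenhuis bracket is $[K,L]_{RN}=\iota_KL-(-1)^{\bar K\bar L}\iota_LK$, extended bilinearly to sums of forms. A (symmetric) $L_\infty$-structure on $E$ is a sum $\mu=\sum_{i\ge1}l_i$ of symmetric vector valued $i$-forms $l_i$ of degree $+1$ with $[\mu,\mu]_{RN}=0$. A symmetric Lie $n$-algebra is a symmetric $L_\infty$-algebra whose underlying graded vector space is concentrated in degrees $-n,\dots,-1$; then only $l_1,\dots,l_{n+1}$ can be non-zero.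 Symmetric Lie $n$-algebra associated to $(M,\omega)$: $E_{-1}=\Omega^{n-1}_{Ham}(M)$ and $E_i=\Omega^{n+i}(M)$ for $-n\le i\le-2$; $l_1(\alpha)=(-1)^{|\alpha|}\mathrm d\alpha$ if $\alpha\notin E_{-1}$, $l_1=0$ on $E_{-1}$; for $k\ge2$, $l_k(\alpha_1,\dots,\alpha_k)=0$ if some $\alpha_i\notin E_{-1}$, and if all $\alpha_i\in E_{-1}$, $l_k(\alpha_1,\dots,\alpha_k)=(-1)^{\frac k2+1}\iota_{\chi_{\alpha_1}}\cdots\iota_{\chi_{\alpha_k}}\omega$ for $k$ even and $(-1)^{\frac{k-1}2}\iota_{\chi_{\alpha_1}}\cdots\iota_{\chi_{\alpha_k}}\omega$ for $k$ odd. For $\mu$ of degree $1$, a symmetric vector valued form $\mathcal N$ of degree $0$ is Nijenhuis with respect to $\mu$ if there is a symmetric vector valued form $\mathcal K$ of degree $0$ with $[\mathcal N,[\mathcal N,\mu]_{RN}]_{RN}=[\mathcal K,\mu]_{RN}$ and $[\mathcal N,\mathcal K]_{RN}=0$. Euler map: $S(X)=-|X|X$ for homogeneous $X$. *)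

(* Defs.v *)
From HB Require Import structures.
From mathcomp Require Import all_boot all_order all_algebra all_fingroup.
From mathcomp Require Import ring zify.
From mathcomp Require Import all_classical all_reals all_analysis.

Set Implicit Arguments.
Unset Strict Implicit.
Unset Printing Implicit Defensive.

Import Order.TTheory GRing.Theory Num.Theory numFieldNormedType.Exports.
Local Open Scope classical_set_scope.
Local Open Scope ring_scope.

Definition partials (R : realType) (m : nat) (g : 'rV[R]_m -> R)
    (I : seq 'I_m) : 'rV[R]_m -> R :=
  foldr (fun i h => 'D_(delta_mx 0 i) h) g I.

(* C^infinity: all partial derivatives, of every order, exist and are continuous
   on U (the list I is the list of variables differentiated along). *)
Definition smooth_on (R : realType) (m : nat) (U : set 'rV[R]_m)
    (g : 'rV[R]_m -> R) : Prop :=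
  forall (I : seq 'I_m) (x : 'rV[R]_m), U x ->
    {for x, continuous (partials g I)} /\
    forall i, derivable (partials g I) x (delta_mx 0 i).

Section SmoothOn.
Variables (R : realType) (m : nat) (U : set 'rV[R]_m).
Hypothesis openU : open U.
Implicit Types (g h : 'rV[R]_m -> R) (I : seq 'I_m).

Lemma partials_rcons g I i :
  partials g (rcons I i) = partials ('D_(delta_mx 0 i) g) I.
Proof. by rewrite /partials -cats1 foldr_cat. Qed.

Lemma partials_eq g h I : (forall x, U x -> g x = h x) ->
  forall x, U x -> partials g I x = partials h I x.
Proof.
move=> gh; elim: I => [|i I IH] x Ux //=; first exact: gh.
apply: near_eq_derive; have := open_nbhs_nbhs (conj openU Ux).
by apply: filterS => y; apply: IH.
Qed.

Definition Ck k g := forall I x, (size I <= k)%N -> U x ->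
    {for x, continuous (partials g I)} /\
    forall i, derivable (partials g I) x (delta_mx 0 i).

Lemma smooth_onP g : smooth_on U g <-> forall k, Ck k g.
Proof. by split=> [sg k I x _|sg I x]; [exact: sg | exact: (sg (size I))]. Qed.

Lemma near_U (P : 'rV[R]_m -> Prop) x : U x -> (forall y, U y -> P y) ->
  \near x, P x.
Proof.
move=> Ux UP; have := open_nbhs_nbhs (conj openU Ux).
by apply: filterS; exact: UP.
Qed.

Lemma Ck_eq k g h : (forall x, U x -> g x = h x) -> Ck k g -> Ck k h.
Proof.
move=> gh sg I x kI Ux; have gE := partials_eq I gh.
have nE := near_U Ux gE.
have [cg dg] := sg I x kI Ux; split.
  rewrite /prop_for /continuous_at -gE//.
  by apply: cvg_trans cg; apply: (near_eq_cvg nE).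
move=> i; have := dg i => /derivableP /(near_eq_is_derive nE).
by move=> [].
Qed.

Lemma smooth_on_eq g h : (forall x, U x -> g x = h x) ->
  smooth_on U g -> smooth_on U h.
Proof. by move=> gh /smooth_onP sg; apply/smooth_onP => k; apply: (Ck_eq gh). Qed.

Lemma partials_cst c I : partials (cst c : 'rV[R]_m -> R) I =
  if I is [::] then cst c else cst 0.
Proof.
elim: I => //= i I ->; apply/funext => x.
by case: I => [|? ?]; rewrite derive_cst.
Qed.

Lemma smooth_on_cst c : smooth_on U (cst c : 'rV[R]_m -> R).
Proof.
move=> I x Ux; rewrite partials_cst.
by case: I => [|? ?]; split=> [|i]; try exact: cst_continuous;
  apply: derivable_cst.
Qed.

Lemma partialsD k g h I : (size I <= k.+1)%N -> Ck k g -> Ck k h ->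
  forall x, U x -> partials (g + h) I x = partials g I x + partials h I x.
Proof.
move=> + sg sh; elim: I => [|i I IH] kI x Ux //=.
have [[_ dg] [_ dh]] := (sg I x kI Ux, sh I x kI Ux).
rewrite -deriveD//.
by apply: near_eq_derive; apply: (near_U Ux) => y Uy; apply: IH => //; exact: ltnW.
Qed.

Lemma CkD k g h : Ck k g -> Ck k h -> Ck k (g + h).
Proof.
move=> sg sh I x kI Ux; have [[cg dg] [ch dh]] := (sg I x kI Ux, sh I x kI Ux).
have nE : \near x, (partials g I + partials h I) x = partials (g + h) I x.
  by apply: (near_U Ux) => y Uy; rewrite (partialsD (leqW kI)).
split.
  rewrite /prop_for /continuous_at (partialsD (leqW kI))//.
  by apply: cvg_trans (cvgD cg ch); apply: (near_eq_cvg nE).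
move=> i; have /derivableP /(near_eq_is_derive nE) := derivableD (dg i) (dh i).
by move=> [].
Qed.

Lemma smooth_onD g h : smooth_on U g -> smooth_on U h -> smooth_on U (g + h).
Proof. by move=> /smooth_onP sg /smooth_onP sh; apply/smooth_onP => k; apply: CkD. Qed.

Lemma smooth_on_partial g i : smooth_on U g -> smooth_on U ('D_(delta_mx 0 i) g).
Proof. by move=> sg I x Ux; rewrite -partials_rcons; apply: sg. Qed.

Lemma smooth_onM g h : smooth_on U g -> smooth_on U h -> smooth_on U (g * h).
Proof.
move=> + + ; move=> sg sh; apply/smooth_onP => k.
elim: k g h sg sh => [|k IH] g h sg sh I x.
  case: I => // _ Ux; have [[cg dg] [ch dh]] := (sg [::] x Ux, sh [::] x Ux).
  by split=> [|i]; [exact: (cvgM cg ch) | exact: (derivableM (dg i) (dh i))].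
case/lastP: I => [_ Ux|I i].
  have [[cg dg] [ch dh]] := (sg [::] x Ux, sh [::] x Ux).
  by split=> [|i]; [exact: (cvgM cg ch) | exact: (derivableM (dg i) (dh i))].
rewrite size_rcons ltnS partials_rcons => kI Ux.
have E : forall x, U x -> (g * 'D_(delta_mx 0 i) h + h * 'D_(delta_mx 0 i) g) x =
    'D_(delta_mx 0 i) (g * h) x.
  move=> y Uy; have [[cg dg] [ch dh]] := (sg [::] y Uy, sh [::] y Uy).
  by rewrite deriveM.
have s1 := smooth_on_partial i sg; have s2 := smooth_on_partial i sh.
by apply: (Ck_eq E (k := k)) => //; apply: CkD; apply: IH.
Qed.
End SmoothOn.

(* Hausdorff, second countable, with a (not necessarily maximal) smooth atlas;
   chart_inv a is only meaningful on chart a @` chart_dom a. *)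
Record smoothManifold (R : realType) (m : nat) := SmoothManifold {
  mcarrier :> topologicalType;
  mcarrier_hausdorff : hausdorff_space mcarrier;
  mcarrier_second_countable : @second_countable mcarrier;
  chart_index : Type;
  chart_dom : chart_index -> set mcarrier;
  chart : chart_index -> mcarrier -> 'rV[R]_m;
  chart_inv : chart_index -> 'rV[R]_m -> mcarrier;
  chart_cover : forall p, exists a, chart_dom a p;
  chart_dom_open : forall a, open (chart_dom a);
  chart_img_open : forall a, open (chart a @` chart_dom a);
  chartK : forall a p, chart_dom a p -> chart_inv a (chart a p) = p;
  chart_continuous : forall a p, chart_dom a p ->
    {for p, continuous (chart a)};
  chart_inv_continuous : forall a x, (chart a @` chart_dom a) x ->
    {for x, continuous (chart_inv a)};
  transition_smooth : forall a b (k : 'I_m),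
    smooth_on (chart a @` (chart_dom a `&` chart_dom b))
      (fun x => chart b (chart_inv a x) ord0 k) }.

Section SmoothFunctions.
Variables (R : realType) (m : nat) (M : smoothManifold R m).

Definition smooth_fun (f : M -> R) : Prop :=
  forall a : chart_index M,
    smooth_on (chart a @` chart_dom a) (fun x => f (chart_inv a x)).

Record Cinf := MkCinf { Cinf_val :> M -> R; _ : `[< smooth_fun Cinf_val >] }.

HB.instance Definition _ := [isSub for Cinf_val].
HB.instance Definition _ := [Choice of Cinf by <:].

Lemma smooth_fun_subring : subring_closed (fun f : M -> R => `[< smooth_fun f >]).
Proof.
have N f : smooth_fun f -> smooth_fun (- f).
  move=> sf a; have := smooth_onM (@chart_img_open _ _ M a) (smooth_on_cst (- 1)) (sf a).
  apply: smooth_on_eq; first exact: chart_img_open.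
  by move=> x _; rewrite /GRing.mul /= mulN1r.
split.
- by apply/asboolP => a; exact: (smooth_on_cst 1).
- move=> f g /asboolP sf /asboolP sg; apply/asboolP => a.
  exact: (smooth_onD (@chart_img_open _ _ M a) (sf a) (N _ sg a)).
- move=> f g /asboolP sf /asboolP sg; apply/asboolP => a.
  exact: (smooth_onM (@chart_img_open _ _ M a) (sf a) (sg a)).
Qed.

HB.instance Definition _ := GRing.SubChoice_isSubComPzRing.Build
  (M -> R) _ Cinf smooth_fun_subring.

Lemma smooth_fun_scale (c : R) (f : Cinf) : `[< smooth_fun (c *: (f : M -> R)) >].
Proof.
apply/asboolP => a; case: f => f /= /asboolP sf.
exact: (smooth_onM (@chart_img_open _ _ M a) (smooth_on_cst c) (sf a)).
Qed.

Definition Cinf_scale (c : R) (f : Cinf) : Cinf := MkCinf (smooth_fun_scale c f).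

Fact Cinf_scaleA a b f : Cinf_scale a (Cinf_scale b f) = Cinf_scale (a * b) f.
Proof. by apply: val_inj; apply/funext => p; exact: mulrA. Qed.
Fact Cinf_scale1 : left_id 1 Cinf_scale.
Proof. by move=> f; apply: val_inj; apply/funext => p; exact: mul1r. Qed.
Fact Cinf_scaleDr : right_distributive Cinf_scale +%R.
Proof. by move=> c f g; apply: val_inj; apply/funext => p; exact: mulrDr. Qed.
Fact Cinf_scaleDl f : {morph Cinf_scale^~ f : a b / a + b}.
Proof. by move=> a b; apply: val_inj; apply/funext => p; exact: mulrDl. Qed.

HB.instance Definition _ := GRing.Zmodule_isLmodule.Build R Cinf
  Cinf_scaleA Cinf_scale1 Cinf_scaleDr Cinf_scaleDl.

Lemma Cinf_scaleAl (c : R) (f g : Cinf) : c *: (f * g) = (c *: f) * g.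
Proof. by apply: val_inj; apply/funext => p; exact: mulrA. Qed.

Definition derivation (D : Cinf -> Cinf) : Prop :=
  (forall (c : R) f g, D (c *: f + g) = c *: D f + D g) /\
  (forall f g, D (f * g) = D f * g + f * D g).

(* Vector fields are taken to be the R-linear derivations of C^infinity(M), as
   in Helgason, Differential Geometry, Lie Groups, and Symmetric Spaces, I.2;
   the scalars of this module are the smooth functions. *)
Record vfield := MkVfield
  { vfield_val :> Cinf -> Cinf^o; _ : `[< derivation vfield_val >] }.

HB.instance Definition _ := [isSub for vfield_val].
HB.instance Definition _ := [Choice of vfield by <:].

Lemma derivation_subsemimod :
  subsemimod_closed (fun D : Cinf -> Cinf^o => `[< derivation D >]).
Proof.
have zE f : (0 : Cinf -> Cinf^o) f = 0 :> Cinf by [].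
have aE (D E : Cinf -> Cinf^o) f : (D + E) f = (D f : Cinf) + E f by [].
have sE h (D : Cinf -> Cinf^o) f : (h *: D) f = h * D f :> Cinf by [].
split; [split|].
- by apply/asboolP; split=> [c f g|f g]; rewrite !zE ?scaler0 ?mulr0 ?mul0r addr0.
- move=> D E /asboolP[Dl DM] /asboolP[El EM]; apply/asboolP; split=> [c f g|f g].
    by rewrite !aE Dl El scalerDr addrACA.
  by rewrite !aE DM EM mulrDl mulrDr addrACA.
- move=> h D /asboolP[Dl DM]; apply/asboolP; split=> [c f g|f g].
    by rewrite !sE Dl mulrDr [h * (c *: _)]mulrC -Cinf_scaleAl [D f * h]mulrC.
  by rewrite !sE DM mulrDr !mulrA [f * h]mulrC.
Qed.

HB.instance Definition _ := GRing.SubChoice_isSubLmodule.Build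
  Cinf (Cinf -> Cinf^o) _ vfield derivation_subsemimod.

Lemma vfieldP (X : vfield) : derivation X.
Proof. by case: X => X /= /asboolP. Qed.

Lemma vbracket_derivation (X Y : vfield) :
  `[< derivation (fun f => X (Y f) - Y (X f)) >].
Proof.
have [[Xl XM] [Yl YM]] := (vfieldP X, vfieldP Y).
have XD f g : X (f + g) = X f + X g by rewrite -[f]scale1r Xl !scale1r.
have YD f g : Y (f + g) = Y f + Y g by rewrite -[f]scale1r Yl !scale1r.
apply/asboolP; split=> [c f g|f g].
  by rewrite Yl Xl Xl Yl scalerBr opprD addrACA.
by rewrite XM YM XD YD !XM !YM; ring.
Qed.

Definition vbracket (X Y : vfield) : vfield := MkVfield (vbracket_derivation X Y).

End SmoothFunctions.

Definition del (T : Type) (i : nat) (s : seq T) : seq T :=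
  take i s ++ drop i.+1 s.

Section Koszul.
(* A family of maps L^k -> A, one for each k, is encoded as one function on
   lists: the component of arity k is its restriction to lists of size k. *)
Variables (A : comPzRingType) (L : lmodType A).
Variables (act : L -> A -> A) (br : L -> L -> L).
Implicit Types (al be : seq L -> A) (X Y Z : L) (s : seq L).

Definition multilinear al : Prop := forall s1 (a : A) X Y s2,
  al (s1 ++ (a *: X + Y) :: s2) = a * al (s1 ++ X :: s2) + al (s1 ++ Y :: s2).

Definition alternating al : Prop := forall s1 X Y s2,
  al (s1 ++ X :: Y :: s2) = - al (s1 ++ Y :: X :: s2).

(* Koszul's formula, with s = [X_0; ..; X_k]:
   sum_i (-1)^i X_i al(..,^X_i,..) +
   sum_(i<j) (-1)^(i+j) al([X_i,X_j],..,^X_i,..,^X_j,..). *)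
Definition koszul_d al s : A :=
  \sum_(i < size s) (-1) ^+ i * act s`_i (al (del i s)) +
  \sum_(j < size s) \sum_(i < j)
    (-1) ^+ (i + j) * al (br s`_i s`_j :: del i (del j s)).

Hypothesis actDl : forall X Y f, act (X + Y) f = act X f + act Y f.
Hypothesis actZl : forall a X f, act (a *: X) f = a * act X f.
Hypothesis actD : forall X f g, act X (f + g) = act X f + act X g.
Hypothesis actM : forall X f g, act X (f * g) = act X f * g + f * act X g.
Hypothesis brC : forall X Y, br X Y = - br Y X.
Hypothesis brDl : forall X Y Z, br (X + Y) Z = br X Z + br Y Z.
Hypothesis brZl : forall a X Z, br (a *: X) Z = a *: br X Z - act Z a *: X.
Hypothesis act_br : forall X Y f,
  act (br X Y) f = act X (act Y f) - act Y (act X f).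
Hypothesis jacobi : forall X Y Z, br X (br Y Z) = br (br X Y) Z + br Y (br X Z).

Fact act0 X : act X 0 = 0.
Proof. by apply: (addIr (act X 0)); rewrite -actD !add0r. Qed.
Fact actN X f : act X (- f) = - act X f.
Proof. by apply/eqP; rewrite -addr_eq0 -actD addNr act0. Qed.
Fact actB X f g : act X (f - g) = act X f - act X g.
Proof. by rewrite actD actN. Qed.

Definition ins X al : seq L -> A := fun s => al (X :: s).

Lemma ins_ml X al : multilinear al -> multilinear (ins X al).
Proof. by move=> h s1; apply: (h (X :: s1)). Qed.
Lemma ins_alt X al : alternating al -> alternating (ins X al).
Proof. by move=> h s1; apply: (h (X :: s1)). Qed.

Lemma alt_head al : alternating al -> forall s1 X s2,
  al (s1 ++ X :: s2) = (-1) ^+ size s1 * al (X :: s1 ++ s2).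
Proof.
move=> h s1; elim: s1 al h => [|Y s1 IH] al h X s2; first by rewrite expr0 mul1r.
have := IH _ (ins_alt Y h) X s2; rewrite /ins /= => ->.
by rewrite (h [::] Y X) mulrN exprS mulN1r mulNr.
Qed.

Lemma alt_nth al : alternating al -> forall s j X, (j <= size s)%N ->
  al (take j s ++ X :: drop j.+1 s) = (-1) ^+ j * al (X :: del j s).
Proof. by move=> h s j X js; rewrite alt_head// size_takel. Qed.

Definition lie X al s : A :=
  act X (al s) - \sum_(j < size s) al (take j s ++ br X s`_j :: drop j.+1 s).

Lemma lie_cons X al Y s : lie X al (Y :: s) = lie X (ins Y al) s - al (br X Y :: s).
Proof.
rewrite /lie /= big_ord_recl /= drop0 opprD addrA addrAC; congr (_ - _).
Qed.

Lemma kd_cons al : alternating al -> forall X s,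
  koszul_d al (X :: s) = lie X al s - koszul_d (ins X al) s.
Proof.
move=> h X s; rewrite /koszul_d /= big_ord_recl /= expr0 mul1r {1}/del take0 /= drop0.
rewrite [X in _ + X = _]big_ord_recl big_ord0 add0r /lie opprD.
rewrite -!addrA; congr (_ + _).
under [X in X + _ = _]eq_bigr => i _ do rewrite /bump /= add1n exprS mulN1r mulNr.
rewrite sumrN addrCA; congr (_ + _).
rewrite -opprD -big_split /=. rewrite -sumrN; apply: eq_bigr => j _ /=.
rewrite /bump /= !add1n big_ord_recl /= opprD; congr (_ + _).
  rewrite (alt_nth h); last exact: ltnW.
  by rewrite add0n exprS mulN1r mulNr {1}/del take0 /= drop0.
rewrite -sumrN; apply: eq_bigr => i _; rewrite /bump /= !add1n addSn addnS !exprS.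
rewrite !mulN1r opprK /ins; rewrite -mulrN; congr (_ * _).
exact: (h [::]).
Qed.

Lemma kd_nil al : koszul_d al [::] = 0.
Proof. by rewrite /koszul_d /= !big_ord0 addr0. Qed.

Lemma kdN al s : koszul_d (fun t => - al t) s = - koszul_d al s.
Proof.
rewrite /koszul_d opprD -!sumrN; congr (_ + _); apply: eq_bigr => j _.
  by rewrite actN mulrN.
by rewrite -sumrN; apply: eq_bigr => i _; rewrite mulrN.
Qed.

Lemma kdD al be s : koszul_d (fun t => al t + be t) s = koszul_d al s + koszul_d be s.
Proof.
rewrite /koszul_d addrACA; congr (_ + _); rewrite -big_split; apply: eq_bigr => j _ /=.
  by rewrite actD mulrDr.
by rewrite -big_split; apply: eq_bigr => i _ /=; rewrite mulrDr.
Qed.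

Lemma eq_kd al be : al =1 be -> koszul_d al =1 koszul_d be.
Proof.
move=> e s; rewrite /koszul_d; congr (_ + _); apply: eq_bigr => j _.
  by rewrite e.
by apply: eq_bigr => i _; rewrite e.
Qed.

Lemma eq_lie X al be : al =1 be -> lie X al =1 lie X be.
Proof.
by move=> e s; rewrite /lie e; congr (_ - _); apply: eq_bigr => j _; rewrite e.
Qed.

Lemma lieN X al s : lie X (fun t => - al t) s = - lie X al s.
Proof. by rewrite /lie actN sumrN -opprD. Qed.
Lemma lieD X al be s : lie X (fun t => al t + be t) s = lie X al s + lie X be s.
Proof. by rewrite /lie actD big_split opprD addrACA. Qed.
Lemma lieB X al be s : lie X (fun t => al t - be t) s = lie X al s - lie X be s.
Proof. by rewrite lieD lieN. Qed.
Lemma kdB al be s : koszul_d (fun t => al t - be t) s = koszul_d al s - koszul_d be s.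
Proof. by rewrite kdD kdN. Qed.

Lemma lie_alt X al : alternating al -> alternating (lie X al).
Proof.
move=> h s1; elim: s1 al h => [|W s1 IH] al h Y Z s2 /=.
  rewrite !lie_cons /ins.
  have -> : lie X (fun t => al [:: Y, Z & t]) s2 = - lie X (fun t => al [:: Z, Y & t]) s2.
    by rewrite -lieN; apply: eq_lie => t; rewrite (h [::]).
  rewrite (h [::] Y (br X Z)) (h [::] (br X Y) Z) /= !opprK !opprD !opprK.
  by rewrite addrAC.
by rewrite !lie_cons (IH _ (ins_alt W h)) (h (br X W :: s1)) /=; ring.
Qed.

Lemma ml_add al X Y s : multilinear al -> al (X + Y :: s) = al (X :: s) + al (Y :: s).
Proof. by move=> h; have := h [::] 1 X Y s; rewrite /= scale1r mul1r. Qed.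
Lemma ml_0 al s : multilinear al -> al (0 :: s) = 0.
Proof. by move=> h; apply: (addIr (al (0 :: s))); rewrite -ml_add// !add0r. Qed.
Lemma ml_opp al X s : multilinear al -> al (- X :: s) = - al (X :: s).
Proof. by move=> h; apply/eqP; rewrite -addr_eq0 -ml_add// addNr ml_0. Qed.
Lemma ml_scale al a X s : multilinear al -> al (a *: X :: s) = a * al (X :: s).
Proof. by move=> h; have := h [::] a X 0 s; rewrite /= addr0 ml_0// addr0. Qed.

Lemma kd_alt al : multilinear al -> alternating al -> alternating (koszul_d al).
Proof.
move=> m h s1; elim: s1 al m h => [|W s1 IH] al m h X Y s2 /=.
  rewrite !kd_cons//; try exact: ins_alt; rewrite !lie_cons.
  have -> : koszul_d (ins Y (ins X al)) s2 = - koszul_d (ins X (ins Y al)) s2.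
    by rewrite -kdN; apply: eq_kd => t; rewrite /ins (h [::]).
  rewrite [br X Y]brC ml_opp //.
  by ring.
rewrite !kd_cons// IH//; [|exact: ins_ml|exact: ins_alt].
by rewrite (lie_alt W h); ring.
Qed.

Lemma kdZ a be s : koszul_d (fun t => a * be t) s =
  a * koszul_d be s + \sum_(i < size s) (-1) ^+ i * (act s`_i a * be (del i s)).
Proof.
rewrite /koszul_d mulrDr addrAC; congr (_ + _).
  rewrite big_distrr -big_split; apply: eq_bigr => i _ /=.
  by rewrite actM; ring.
rewrite big_distrr; apply: eq_bigr => j _ /=.
by rewrite big_distrr; apply: eq_bigr => i _ /=; ring.
Qed.

Lemma brl a X Y Z : br (a *: X + Y) Z = a *: br X Z + (- act Z a *: X + br Y Z).
Proof. by rewrite brDl brZl scaleNr addrA. Qed.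

Lemma kd_head al a X Y s : multilinear al -> alternating al ->
  koszul_d al (a *: X + Y :: s) = a * koszul_d al (X :: s) + koszul_d al (Y :: s).
Proof.
move=> m h; rewrite !kd_cons//.
have e : ins (a *: X + Y) al =1 (fun t => a * ins X al t + ins Y al t).
  by move=> t; apply: (m [::]).
rewrite (eq_kd e) kdD kdZ /lie actDl actZl.
have -> : \sum_(j < size s) al (take j s ++ br (a *: X + Y) s`_j :: drop j.+1 s) =
    a * \sum_(j < size s) al (take j s ++ br X s`_j :: drop j.+1 s)
    + \sum_(j < size s) al (take j s ++ br Y s`_j :: drop j.+1 s)
    - \sum_(i < size s) (-1) ^+ i * (act s`_i a * ins X al (del i s)).
  rewrite -sumrN big_distrr -!big_split; apply: eq_bigr => j _ /=.
  rewrite brl !m (alt_nth h X); last exact: ltnW.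
  by rewrite /ins; ring.
by ring.
Qed.

Lemma kd_ml al : multilinear al -> alternating al -> multilinear (koszul_d al).
Proof.
move=> m h s1 a X Y s2; have k := kd_alt m h.
by rewrite !(alt_head k) kd_head//; ring.
Qed.

Lemma lie_comm al X Y s : multilinear al ->
  lie X (lie Y al) s - lie Y (lie X al) s = lie (br X Y) al s.
Proof.
elim: s al => [|Z s IH] al m.
  by rewrite /lie !big_ord0 !subr0 act_br.
rewrite !lie_cons -IH; last exact: ins_ml.
have e U V : lie U (ins Z (lie V al)) s =
    lie U (lie V (ins Z al)) s - lie U (ins (br V Z) al) s.
  by rewrite -lieB; apply: eq_lie => t; rewrite /ins lie_cons.
rewrite !e.
have -> : al (br (br X Y) Z :: s) = al (br X (br Y Z) :: s) - al (br Y (br X Z) :: s).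
  by rewrite jacobi ml_add// addrK.
by ring.
Qed.

Lemma lie_kd al X s : multilinear al -> alternating al ->
  lie X (koszul_d al) s = koszul_d (lie X al) s.
Proof.
elim: s al => [|Y s IH] al m h.
  by rewrite /lie big_ord0 !kd_nil act0 subr0.
have hX := lie_alt X h.
rewrite lie_cons !kd_cons//.
have e1 : ins Y (koszul_d al) =1 (fun t => lie Y al t - koszul_d (ins Y al) t).
  by move=> t; rewrite /ins kd_cons.
have e2 : ins Y (lie X al) =1 (fun t => lie X (ins Y al) t - ins (br X Y) al t).
  by move=> t; rewrite /ins lie_cons.
rewrite (eq_lie X e1) (eq_kd e2) lieB kdB IH; [|exact: ins_ml|exact: ins_alt].
by rewrite -(lie_comm X Y s m); ring.
Qed.

Lemma kd_kd al s : multilinear al -> alternating al -> koszul_d (koszul_d al) s = 0.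
Proof.
elim: s al => [|X s IH] al m h; first exact: kd_nil.
have k := kd_alt m h; rewrite kd_cons// lie_kd//.
have e1 : ins X (koszul_d al) =1 (fun t => lie X al t - koszul_d (ins X al) t).
  by move=> t; rewrite /ins kd_cons.
by rewrite (eq_kd e1) kdB IH ?subrr ?subr0 ?subrr//; [exact: ins_ml|exact: ins_alt].
Qed.

Lemma kd_ins2 om X Y s : alternating om ->
  (forall t, koszul_d om t = 0) -> (forall t, koszul_d (ins X om) t = 0) ->
  (forall t, koszul_d (ins Y om) t = 0) ->
  koszul_d (ins X (ins Y om)) s = om (br X Y :: s).
Proof.
move=> h cl cX cY.
have LX t : lie X om t = 0.
  by have := kd_cons h X t; rewrite cl cX subr0 => <-.
have := kd_cons (ins_alt Y h) X s; rewrite cY => /esym/subr0_eq <-.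
by have := lie_cons X om Y s; rewrite LX => /esym/subr0_eq.
Qed.

End Koszul.

Section Forms.
Variables (R : realType) (m : nat) (M : smoothManifold R m).
Local Notation vf := (vfield M).
Local Notation A := (Cinf M).

(* As in Helgason, k-forms are the alternating C^infinity(M)-multilinear maps
   vfield^k -> C^infinity(M). A [dform] is a form of mixed degree: its k-form
   component is its restriction to lists of size k. *)
Definition is_form (al : seq vf -> A) : Prop := multilinear al /\ alternating al.

Record dform := MkDform { dform_val :> seq vf -> A; _ : `[< is_form dform_val >] }.

HB.instance Definition _ := [isSub for dform_val].
HB.instance Definition _ := [Choice of dform by <:].

Lemma is_form_subsemimod :
  subsemimod_closed (fun al : seq vf -> A => `[< is_form al >]).
Proof.
have zE s : (0 : seq vf -> A) s = 0 :> A by [].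
have aE (f g : seq vf -> A) s : (f + g) s = f s + g s by [].
have sE (c : R) (f : seq vf -> A) s : (c *: f) s = c *: f s by [].
split; [split|].
- by apply/asboolP; split=> [s1 a X Y s2|s1 X Y s2]; rewrite !zE ?mulr0 ?addr0 ?oppr0.
- move=> f g /asboolP[fm fa] /asboolP[gm ga]; apply/asboolP.
  split=> [s1 a X Y s2|s1 X Y s2]; rewrite !aE.
    by rewrite fm gm; ring.
  by rewrite fa ga opprD.
- move=> c f /asboolP[fm fa]; apply/asboolP.
  split=> [s1 a X Y s2|s1 X Y s2]; rewrite !sE.
    by rewrite fm scalerDr [a * f _]mulrC Cinf_scaleAl mulrC.
  by rewrite fa scalerN.
Qed.

HB.instance Definition _ := GRing.SubChoice_isSubLmodule.Build
  R (seq vf -> A) _ dform is_form_subsemimod.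

Lemma dformP (al : dform) : is_form al.
Proof. by case: al => al /= /asboolP. Qed.

Lemma dform_ext (al be : dform) : (forall s, al s = be s) -> al = be.
Proof. by move=> e; apply: val_inj; apply/funext. Qed.

Lemma form_part_proof (k : int) (al : dform) :
  `[< is_form (fun s => if (size s)%:Z == k then al s else 0) >].
Proof.
have [am aa] := dformP al; apply/asboolP.
split=> [s1 a X Y s2|s1 X Y s2]; rewrite !size_cat /=; case: ifP => _.
- exact: am.
- by rewrite mulr0 addr0.
- exact: aa.
- by rewrite oppr0.
Qed.
Definition form_part (k : int) (al : dform) : dform := MkDform (form_part_proof k al).

Lemma iprod_proof (X : vf) (al : dform) : `[< is_form (ins X al) >].
Proof.
have [am aa] := dformP al; apply/asboolP.
by split; [exact: ins_ml|exact: ins_alt].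
Qed.
Definition iprod (X : vf) (al : dform) : dform := MkDform (iprod_proof X al).

Let act (X : vf) (f : A) : A := X f.

Implicit Types (X Y Z : vf) (a f g : A).
Fact actDl X Y f : act (X + Y) f = act X f + act Y f. Proof. by []. Qed.
Fact actZl a X f : act (a *: X) f = a * act X f. Proof. by []. Qed.
Fact actD X f g : act X (f + g) = act X f + act X g.
Proof. by have [Xl _] := vfieldP X; have := Xl 1 f g; rewrite !scale1r. Qed.
Fact actM X f g : act X (f * g) = act X f * g + f * act X g.
Proof. by have [_ XM] := vfieldP X; exact: XM. Qed.
Fact vfield_ext (X Y : vf) : (forall f : A, act X f = act Y f) -> X = Y.
Proof. by move=> e; apply: val_inj; apply/funext. Qed.
Fact actNl X f : act (- X) f = - act X f. Proof. by []. Qed.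
Fact act_vbracket X Y f : act (vbracket X Y) f = act X (act Y f) - act Y (act X f).
Proof. by []. Qed.
Fact vbracketC X Y : vbracket X Y = - vbracket Y X.
Proof. by apply: vfield_ext => f; rewrite actNl !act_vbracket opprB. Qed.
Fact vbracketDl X Y Z : vbracket (X + Y) Z = vbracket X Z + vbracket Y Z.
Proof. by apply: vfield_ext => f; rewrite actDl !act_vbracket !actDl actD; ring. Qed.
Fact vbracketZl a X Z : vbracket (a *: X) Z = a *: vbracket X Z - act Z a *: X.
Proof.
apply: vfield_ext => f.
by rewrite actDl actNl !actZl !act_vbracket !actZl actM; ring.
Qed.
Fact vbracket_jacobi X Y Z :
  vbracket X (vbracket Y Z) = vbracket (vbracket X Y) Z + vbracket Y (vbracket X Z).
Proof.
have actB U f g : act U (f - g) = act U f - act U g.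
  exact: (actB actD).
by apply: vfield_ext => f; rewrite actDl !act_vbracket !actB; ring.
Qed.

Definition dval (al : seq vf -> A) : seq vf -> A :=
  koszul_d (fun X f => X f) (@vbracket R m M) al.

Lemma ext_d_proof (al : dform) : `[< is_form (dval al) >].
Proof.
have [am aa] := dformP al; apply/asboolP; split.
  exact: (kd_ml actDl actZl actD actM vbracketC vbracketDl vbracketZl am aa).
exact: (kd_alt actD vbracketC am aa).
Qed.
Definition ext_d (al : dform) : dform := MkDform (ext_d_proof al).

Lemma ext_d_d al : ext_d (ext_d al) = 0.
Proof.
apply: dform_ext => s; have [am aa] := dformP al.
exact: (kd_kd actD vbracketC act_vbracket vbracket_jacobi).
Qed.

Lemma ext_dD al be : ext_d (al + be) = ext_d al + ext_d be.
Proof. by apply: dform_ext => s; exact: (kdD (act := act) (@vbracket _ _ _) actD). Qed.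

Lemma ext_dZ (c : R) al : ext_d (c *: al) = c *: ext_d al.
Proof.
have sM (f g : A) : f * (c *: g) = c *: (f * g).
  by rewrite mulrC -Cinf_scaleAl mulrC.
have dE be s : ext_d be s = koszul_d act (@vbracket _ _ _) be s by [].
have sE be s : (c *: be : dform) s = c *: (be s : A) by [].
apply: dform_ext => s; rewrite sE !dE /koszul_d scalerDr !scaler_sumr.
congr (_ + _); apply: eq_bigr => i _.
  rewrite sE; have [Xl _] := vfieldP s`_i; have := Xl c (al (del i s)) 0.
  have -> : (s`_i : A -> A) 0 = 0 by exact: (act0 actD).
  by rewrite !addr0 /act => ->; rewrite sM.
by rewrite scaler_sumr; apply: eq_bigr => j _; rewrite sE sM.
Qed.

Definition is_kform (k : int) (al : dform) : Prop :=
  forall s, (size s)%:Z != k -> al s = 0.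

Lemma form_partE k al s : form_part k al s = if (size s)%:Z == k then al s else 0.
Proof. by []. Qed.

Lemma form_part_linear k (c : R) al be :
  form_part k (c *: al + be) = c *: form_part k al + form_part k be.
Proof.
apply: dform_ext => s; rewrite form_partE.
have E (x y : dform) : (c *: x + y) s = c *: (x s : A) + y s by [].
by rewrite !E !form_partE; case: ifP => // _; rewrite scaler0 addr0.
Qed.

Lemma kform_part k al : is_kform k (form_part k al).
Proof. by move=> s /negbTE h; rewrite form_partE h. Qed.

Lemma form_part_kform k j al : is_kform k al ->
  form_part j al = if j == k then al else 0.
Proof.
move=> h; apply: dform_ext => s; rewrite form_partE.
case: (eqVneq j k) => [->|jk]; case: eqVneq => // sk.
- by rewrite h.
- by rewrite h// sk.
Qed.

Lemma size_del (T : Type) i (s : seq T) : (i < size s)%N -> size (del i s) = (size s).-1.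
Proof.
move=> h; rewrite /del size_cat size_drop size_takel; last exact: ltnW.
by rewrite subnS; lia.
Qed.

Lemma kform_ext_d k al : is_kform k al -> is_kform (k + 1) (ext_d al).
Proof.
move=> h s sk.
have k' j : (0 < size s)%N -> j = (size s).-1 -> j%:Z != k.
  by move=> s0 ->; apply: contra sk => /eqP <-; apply/eqP; lia.
rewrite /ext_d /= /dval /koszul_d !big1 ?addr0// => j _.
  rewrite big1// => i _; rewrite h ?mulr0//; apply: k'; first by case: j i => /=; lia.
  have ij := ltn_ord i; have js := ltn_ord j.
  have e1 := size_del js.
  have s2 : (1 < size s)%N by apply: leq_ltn_trans js; apply: leq_ltn_trans ij.
  have i2 : (i < (size s).-1)%N.
    by apply: leq_trans ij _; rewrite -ltnS prednK //; exact: ltnW.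
  by rewrite /= size_del e1 // prednK // -ltnS prednK //; exact: ltnW.
have a0 : (s`_j : A -> A) 0 = 0 by exact: (act0 actD).
have s0 : (0 < size s)%N by exact: leq_ltn_trans (ltn_ord j).
by rewrite h ?a0 ?mulr0//; apply: k' => //; rewrite size_del.
Qed.

Lemma iprodE X al s : iprod X al s = al (X :: s). Proof. by []. Qed.

(* iprod X_1 (iprod X_2 (.. (iprod X_k al))) for Xs = [X_1; ..; X_k] *)
Definition contract (Xs : seq vf) (al : dform) : dform := foldr iprod al Xs.

Lemma kform_contract k Xs al : is_kform k al ->
  is_kform (k - (size Xs)%:Z) (contract Xs al).
Proof.
move=> h; elim: Xs => [|X Xs IH] s; first by rewrite subr0; exact: h.
move=> sk; rewrite [contract _ _ _]iprodE IH//.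
by apply: contra sk => /eqP /= e; apply/eqP => /=; lia.
Qed.

End Forms.

(* Only the global form of non-degeneracy is required: it is implied by
   injectivity of v |-> iprod v w on every tangent space. *)
Record nplectic (R : realType) (m : nat) (M : smoothManifold R m) (n : nat) :=
  NPlectic {
    nplectic_form :> dform M;
    nplectic_kform : is_kform n.+1%:Z nplectic_form;
    nplectic_closed : ext_d nplectic_form = 0;
    nplectic_nondegenerate : forall X, iprod X nplectic_form = 0 -> X = 0 }.

(* x = sum_i gpart i x is the decomposition of x into homogeneous components;
   gsupp x is any finite list of degrees outside of which these vanish. *)
Record gradedSpace (F : fieldType) := GradedSpace {
  gspace :> lmodType F;
  gpart : int -> gspace -> gspace;
  gsupp : gspace -> seq int;
  gpart_linear : forall i (c : F) x y,
    gpart i (c *: x + y) = c *: gpart i x + gpart i y;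
  gpart_part : forall i j x,
    gpart i (gpart j x) = if i == j then gpart i x else 0;
  gsupp_uniq : forall x, uniq (gsupp x);
  gpart_sum : forall x, x = \sum_(i <- gsupp x) gpart i x }.

Section VectorValuedForms.
Variables (F : fieldType) (E : gradedSpace F).

Definition homogeneous (i : int) (x : E) : Prop := gpart i x = x.

(* A formal sum K_0 + K_1 + K_2 + .. of k-linear maps K_k : E^k -> E is encoded
   as one function on lists, K_k being its restriction to lists of size k.
   [is_vvform d K]: each K_k is a symmetric vector valued k-form of degree d. *)
Definition is_vvform (d : int) (K : seq E -> E) : Prop :=
  [/\ forall s1 (c : F) x y s2,
        K (s1 ++ (c *: x + y) :: s2) = c *: K (s1 ++ x :: s2) + K (s1 ++ y :: s2),
      forall s1 i x j y s2, homogeneous i x -> homogeneous j y ->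
        K (s1 ++ x :: y :: s2) = (-1) ^ (i * j) *: K (s1 ++ y :: x :: s2)
    & forall t : seq (int * E), (forall u, u \in t -> homogeneous u.1 u.2) ->
        homogeneous (\sum_(u <- t) u.1 + d) (K [seq u.2 | u <- t])].

(* Multilinear extension of G, given on lists of pairs (degree, homogeneous
   element of that degree). *)
Fixpoint mlext (G : seq (int * E) -> E) (s : seq E) : E :=
  if s is x :: s' then
    \sum_(i <- gsupp x) mlext (fun t => G ((i, gpart i x) :: t)) s'
  else G [::].

(* (k, p - k)-unshuffles, 0-based *)
Definition unshuffle (p k : nat) (sg : 'S_p) : bool :=
  [forall i : 'I_p, forall j : 'I_p,
    [&& (i < j)%N & (j < k)%N || (k <= i)%N] ==> (sg i < sg j)%N].

(* X_0 .. X_(p-1) = koszul_sign deg sg * X_(sg 0) .. X_(sg (p-1)) in the graded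
   symmetric algebra, when X_i has degree deg i *)
Definition koszul_sign (p : nat) (deg : 'I_p -> int) (sg : 'S_p) : F :=
  \prod_(i < p) \prod_(j < p | (i < j)%N && (sg j < sg i)%N)
    (-1) ^ (deg (sg i) * deg (sg j)).

(* iota_K L. In arity p this collects all K_k and L_l with k + l - 1 = p. *)
Definition vv_ins (K L : seq E -> E) : seq E -> E :=
  mlext (fun t =>
    let p := size t in
    let X (i : 'I_p) := tnth (in_tuple t) i in
    \sum_(k < p.+1) \sum_(sg : 'S_p | unshuffle k sg)
      koszul_sign (fun i => (X i).1) sg *:
        L (K [seq (X (sg i)).2 | i : 'I_p <- enum 'I_p & (i < k)%N]
           :: [seq (X (sg i)).2 | i : 'I_p <- enum 'I_p & (k <= i)%N])).

(* The integers are the degrees of K and L. *)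
Definition rn_bracket (dK dL : int) (K L : seq E -> E) : seq E -> E :=
  fun s => vv_ins K L s - (-1) ^ (dK * dL) *: vv_ins L K s.

Definition nijenhuis (mu N : seq E -> E) : Prop :=
  [/\ is_vvform 1 mu, is_vvform 0 N &
    exists2 K : seq E -> E, is_vvform 0 K &
      rn_bracket 0 1 N (rn_bracket 0 1 N mu) =1 rn_bracket 0 1 K mu /\
      rn_bracket 0 0 N K =1 (fun=> 0)].

Definition euler_map (s : seq E) : E :=
  if s is [:: x] then \sum_(i <- gsupp x) (- i)%:~R *: gpart i x else 0.

End VectorValuedForms.

Section AssociatedLieAlgebra.
Variables (R : realType) (m : nat) (M : smoothManifold R m) (n : nat).
Variable (w : nplectic M n).

Definition hamiltonian_for (al : dform M) : set (vfield M) :=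
  [set X | ext_d al = - iprod X w].

(* The space E, as the space of mixed forms of degrees 0, .., n-1 whose
   component of degree n-1 is Hamiltonian; the k-form part sits in degree k-n. *)
Definition in_assoc (al : dform M) : Prop :=
  (forall s, (n <= size s)%N -> al s = 0) /\
  exists X, hamiltonian_for (form_part (n%:Z - 1) al) X.

Record assocE := MkAssocE { assoc_val :> dform M; _ : `[< in_assoc assoc_val >] }.
HB.instance Definition _ := [isSub for assoc_val].
HB.instance Definition _ := [Choice of assocE by <:].

Lemma iprod_scale (c : R) X : iprod ((c *: (1 : Cinf M)) *: X) w = c *: iprod X w.
Proof.
apply: dform_ext => s; have [wm _] := dformP w.
have E (x : dform M) : (c *: x) s = c *: (x s : Cinf M) by [].
by rewrite E !iprodE (ml_scale _ _ _ wm) -Cinf_scaleAl mul1r.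
Qed.
Lemma iprod_add X Y : iprod (X + Y) w = iprod X w + iprod Y w.
Proof. by apply: dform_ext => s; have [wm _] := dformP w; exact: (ml_add _ _ _ wm). Qed.
Lemma iprod0 : iprod 0 w = 0.
Proof. by apply: (addIr (iprod 0 w)); rewrite -iprod_add !add0r. Qed.
Lemma iprod_opp X : iprod (- X) w = - iprod X w.
Proof. by apply/eqP; rewrite -addr_eq0 -iprod_add addNr iprod0. Qed.

Lemma form_part0 k : form_part k (0 : dform M) = 0.
Proof. by apply: dform_ext => s; rewrite form_partE; exact: if_same. Qed.
Lemma form_partD k (x y : dform M) : form_part k (x + y) = form_part k x + form_part k y.
Proof. by have := form_part_linear k 1 x y; rewrite !scale1r. Qed.
Lemma form_partZ k c (x : dform M) : form_part k (c *: x) = c *: form_part k x.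
Proof. by have := form_part_linear k c x 0; rewrite form_part0 !addr0. Qed.
Lemma ext_d0 : ext_d (0 : dform M) = 0.
Proof. by have := ext_dZ 0 (0 : dform M); rewrite !scale0r. Qed.

Lemma in_assoc_subsemimod : subsemimod_closed (fun al => `[< in_assoc al >]).
Proof.
split; [split|].
- apply/asboolP; split=> //; exists 0.
  by rewrite /hamiltonian_for /= form_part0 ext_d0 iprod0 oppr0.
- move=> x y /asboolP[x0 [X hX]] /asboolP[y0 [Y hY]]; apply/asboolP; split=> [s ns|].
    by have -> : (x + y) s = x s + y s :> Cinf M by []; rewrite x0// y0// addr0.
  by exists (X + Y); rewrite /hamiltonian_for /= form_partD ext_dD hX hY iprod_add opprD.
- move=> c x /asboolP[x0 [X hX]]; apply/asboolP; split=> [s ns|].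
    by have -> : (c *: x) s = c *: (x s : Cinf M) by []; rewrite x0// scaler0.
  exists ((c *: (1 : Cinf M)) *: X).
  by rewrite /hamiltonian_for /= form_partZ ext_dZ hX iprod_scale scalerN.
Qed.
HB.instance Definition _ := GRing.SubChoice_isSubLmodule.Build
  R (dform M) _ assocE in_assoc_subsemimod.

Lemma assocEP (x : assocE) : in_assoc x.
Proof. by case: x => x /= /asboolP. Qed.

Lemma assoc_ext (x y : assocE) : (forall s, x s = y s) -> x = y.
Proof. by move=> e; apply: val_inj; apply: dform_ext. Qed.

Lemma form_part_part j k (al : dform M) :
  form_part j (form_part k al) = if j == k then form_part k al else 0.
Proof. by apply: form_part_kform; apply: kform_part. Qed.

Lemma assoc_part_proof (i : int) (x : assocE) : `[< in_assoc (form_part (n%:Z + i) x) >].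
Proof.
have [x0 [X hX]] := assocEP x; apply/asboolP; split=> [s ns|].
  by rewrite form_partE x0// if_same.
rewrite form_part_part; case: eqVneq => [<-|_]; first by exists X.
by exists 0; rewrite /hamiltonian_for /= ext_d0 iprod0 oppr0.
Qed.
Definition assoc_part (i : int) (x : assocE) : assocE := MkAssocE (assoc_part_proof i x).

Definition assoc_degrees (x : assocE) : seq int := [seq - k.+1%:Z | k <- iota 0 n].

Fact assoc_part_linear i (c : R) (x y : assocE) :
  assoc_part i (c *: x + y) = c *: assoc_part i x + assoc_part i y.
Proof. by apply: val_inj; exact: form_part_linear. Qed.

Fact assoc_part_part i j x : assoc_part i (assoc_part j x) = if i == j then assoc_part i x else 0.
Proof.
apply: val_inj => /=; rewrite form_part_part (inj_eq (addrI _)).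
by case: eqVneq => [->|].
Qed.

Fact assoc_degrees_uniq x : uniq (assoc_degrees x).
Proof. by rewrite map_inj_uniq ?iota_uniq// => a b; lia. Qed.

Fact assoc_sumE (I : Type) (r : seq I) (P : pred I) (F : I -> assocE) s :
  (\sum_(i <- r | P i) F i) s = \sum_(i <- r | P i) (F i s : Cinf M).
Proof.
elim/big_rec2: _ => [|i y1 y2 _ <-]; by [].
Qed.

Fact assoc_part_sum x : x = \sum_(i <- assoc_degrees x) assoc_part i x.
Proof.
apply: assoc_ext => s; rewrite assoc_sumE.
have [x0 _] := assocEP x.
have E i : assoc_part i x s = if (size s)%:Z == n%:Z + i then x s else 0 by [].
case: (leqP n (size s)) => ns.
  by rewrite x0// big1_seq// => i _; rewrite E x0// if_same.
rewrite (bigD1_seq ((size s)%:Z - n%:Z)) ?assoc_degrees_uniq//=; last first.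
  apply/mapP; exists (n - (size s).+1)%N; last by lia.
  by rewrite mem_iota; lia.
rewrite subrKC eqxx big1 ?addr0// => i ih.
by case: eqVneq => // e; case/negP: ih; apply/eqP; lia.
Qed.

Definition assoc_graded : gradedSpace R :=
  GradedSpace assoc_part_linear assoc_part_part assoc_degrees_uniq assoc_part_sum.

(* Hamiltonian vector field of the degree -1 component of x; it vanishes as soon
   as this component does. *)
Definition ham_vf (x : assocE) : vfield M :=
  xget 0 (hamiltonian_for (assoc_part (-1) x)).

Lemma ham_vfP x : hamiltonian_for (assoc_part (-1) x) (ham_vf x).
Proof.
rewrite /ham_vf; case: xgetP => // h; have [_ [X hX]] := assocEP x.
by have := h X; case.
Qed.

(* The default value 0 is never used: see assoc_l1E, assoc_lkE and
   eta_tildeE. *)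
Definition to_assoc (al : dform M) : assocE := insubd 0 al.

Lemma to_assocE al : in_assoc al -> to_assoc al = al :> dform M.
Proof. by move=> h; apply: insubdK; apply/asboolP. Qed.

Lemma hamiltonian_unique al X Y :
  hamiltonian_for al X -> hamiltonian_for al Y -> X = Y.
Proof.
rewrite /hamiltonian_for /= => -> /oppr_inj e; apply: subr0_eq.
by apply: (@nplectic_nondegenerate _ _ _ _ w); rewrite iprod_add iprod_opp e subrr.
Qed.

Lemma in_assocD x y : in_assoc x -> in_assoc y -> in_assoc (x + y).
Proof.
have [[_ h] _] := in_assoc_subsemimod.
by move=> /asboolP a /asboolP b; apply/asboolP; apply: h.
Qed.
Lemma in_assocZ c x : in_assoc x -> in_assoc (c *: x).
Proof.
have [_ h] := in_assoc_subsemimod.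
by move=> /asboolP a; apply/asboolP; apply: h.
Qed.
Lemma in_assoc0 : in_assoc 0.
Proof. by have [[h _] _] := in_assoc_subsemimod; apply/asboolP. Qed.

Lemma kform_in_assoc k al : is_kform k al -> k < n%:Z ->
  (k = n%:Z - 1 -> exists X, hamiltonian_for al X) -> in_assoc al.
Proof.
move=> ak kn h; split=> [s ns|]; first by apply: ak; lia.
rewrite (form_part_kform _ ak); case: eqVneq => [/esym|] e; first exact: h.
by exists 0; rewrite /hamiltonian_for /= ext_d0 iprod0 oppr0.
Qed.

Definition l1_form (x : assocE) : dform M :=
  \sum_(i <- assoc_degrees x | i != -1) (-1) ^ i *: ext_d (assoc_part i x).

Lemma l1_in x : in_assoc (l1_form x).
Proof.
rewrite /l1_form big_seq_cond; elim/big_ind: _ => [|a b|i /andP[ix i1]].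
- exact: in_assoc0.
- exact: in_assocD.
apply: in_assocZ; apply: (@kform_in_assoc (n%:Z + i + 1)).
- exact/kform_ext_d/kform_part.
- by move: ix => /mapP[k _ ik]; lia.
by move=> _; exists 0; rewrite /hamiltonian_for /= ext_d_d iprod0 oppr0.
Qed.

(* ham_vf only sees degree -1 components, so that lk_form is multilinear and
   vanishes when some homogeneous argument is not of degree -1; likewise for
   eta_tilde below. *)
Definition lk_form (s : seq assocE) : dform M :=
  (-1) ^+ (if odd (size s) then (size s)./2 else (size s)./2.+1) *:
    contract [seq ham_vf x | x <- s] w.

Lemma ext_d_opp (x : dform M) : ext_d (- x) = - ext_d x.
Proof. by rewrite -[- x]scaleN1r ext_dZ scaleN1r. Qed.

Lemma iprod_ham_closed x : ext_d (iprod (ham_vf x) w) = 0.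
Proof.
have := ham_vfP x; rewrite /hamiltonian_for /= => h.
by rewrite -[iprod _ _]opprK -h ext_d_opp ext_d_d oppr0.
Qed.

Lemma ext_d_val (al be : dform M) : ext_d al = be -> forall s, ext_d al s = be s.
Proof. by move=> ->. Qed.

Lemma ham_bracket x y :
  ext_d (iprod (ham_vf x) (iprod (ham_vf y) w)) =
  iprod (vbracket (ham_vf x) (ham_vf y)) w.
Proof.
apply: dform_ext => s; have [wm wa] := dformP w.
have z (be : dform M) : ext_d be = 0 -> forall t, dval be t = 0.
  by move=> e t; exact: (ext_d_val e t).
apply: (@kd_ins2 (Cinf M) (vfield M) (fun X f => X f) (@vbracket R m M) w) => //.
- exact: (z w (nplectic_closed w)).
- exact: (z (iprod (ham_vf x) w) (iprod_ham_closed x)).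
- exact: (z (iprod (ham_vf y) w) (iprod_ham_closed y)).
Qed.

Lemma lk_in s : (1 < size s)%N -> in_assoc (lk_form s).
Proof.
move=> s1; apply: in_assocZ.
have ck := @kform_contract _ _ M _ [seq ham_vf x | x <- s] _
  (@nplectic_kform _ _ _ _ w).
apply: (kform_in_assoc ck); rewrite size_map; first by lia.
move=> e; have {e}: size s = 2%N by lia.
case: s {s1 ck} => [|x [|y []]]//= _.
exists (- vbracket (ham_vf x) (ham_vf y)).
by rewrite /hamiltonian_for /= ham_bracket iprod_opp opprK.
Qed.

Definition assoc_l (k : nat) (s : seq assocE) : assocE :=
  if size s != k then 0
  else if s is [:: x] then to_assoc (l1_form x) else to_assoc (lk_form s).

Lemma assoc_l1E x : assoc_l 1 [:: x] = l1_form x :> dform M.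
Proof. exact: to_assocE (l1_in x). Qed.

Lemma assoc_lkE s : (1 < size s)%N -> assoc_l (size s) s = lk_form s :> dform M.
Proof.
move=> h; rewrite /assoc_l eqxx /=.
by have := to_assocE (lk_in h); case: s h => [|x [|y s]].
Qed.

Definition assoc_mu (s : seq assocE) : assocE :=
  \sum_(1 <= k < n.+2) assoc_l k s.

Definition eta_tilde (eta : dform M) (i : nat) (s : seq assocE) : assocE :=
  if size s == i then to_assoc (contract [seq ham_vf x | x <- s] eta) else 0.

Lemma eta_in eta s : is_kform n%:Z eta -> (1 < size s)%N ->
  in_assoc (contract [seq ham_vf x | x <- s] eta).
Proof.
move=> h s1.
have ck := @kform_contract _ _ M _ [seq ham_vf x | x <- s] _ h.
apply: (kform_in_assoc ck); rewrite size_map; first by lia.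
by move=> e; lia.
Qed.

Lemma eta_tildeE eta s : is_kform n%:Z eta -> (1 < size s)%N ->
  eta_tilde eta (size s) s = contract [seq ham_vf x | x <- s] eta :> dform M.
Proof. by move=> h s1; rewrite /eta_tilde eqxx (to_assocE (eta_in h s1)). Qed.

(* Pointwise convergence of forms: convergence in R of the values on all vector
   fields Y at all points p. *)
Definition ptwise_cvg (u : nat -> assocE) (x : assocE) : Prop :=
  forall Y (p : M), (fun J => u J Y p : R) @ \oo --> (x Y p : R).

(* N = S + sum_(j >= 1) sum_(2 <= i <= n) eta_tilde (eta j) i *)
Definition is_euler_plus_tildes (eta : nat -> dform M)
    (N : seq assocE -> assocE) : Prop :=
  forall s, ptwise_cvg
    (fun J => (euler_map (E := assoc_graded) s : assocE) +
      \sum_(1 <= j < J) \sum_(2 <= i < n.+1) eta_tilde (eta j) i s) (N s).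

End AssociatedLieAlgebra.

(* Main.v *)
Require Import Defs.
From mathcomp Require Import all_boot all_order all_algebra all_fingroup.
From mathcomp Require Import ring zify.
From mathcomp Require Import all_classical all_reals all_analysis.

Set Implicit Arguments.
Unset Strict Implicit.
Unset Printing Implicit Defensive.

Import Order.TTheory GRing.Theory Num.Theory numFieldNormedType.Exports.

Local Open Scope ring_scope.

(** Write N = S + H, where H is the sum of the contractions [eta_tilde].

    The Euler map counts degrees: [S, L] = d L for every vector valued form L
    of degree d ([rn_bracket_euler]), because inserting S into the arguments
    multiplies L by minus the sum of their degrees, and applying S to the value
    multiplies L by minus the degree of the value. So [S, mu] = mu and
    [S, H] = [S, S] = 0, and as [H, H] = 0 for every form of degree 0,

      [N, [N, mu]] = mu + 2 [H, mu] + [H, [H, mu]].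

    With K = S + 2 H one gets [K, mu] = mu + 2 [H, mu] and [N, K] = 0. Thus N
    is Nijenhuis as soon as [H, [H, mu]] = 0 ([euler_add_nijenhuis]).

    That this double bracket vanishes ([double_rn_bracket_eq0]) is a matter of
    degrees. Say that x in E is negligible if its Hamiltonian vector field is 0;
    all homogeneous x of degree other than -1 are. H and l_k, for k >= 2, only see
    the Hamiltonian vector fields of their arguments, so they vanish when one
    argument is negligible. On the other hand the values of H are negligible, as
    they have degree at most -2, and the values of l_1 are negligible, as they
    are exact or of degree at most -2. Consequently the only terms of
    Q = [H, mu] that survive are l_1 (H (..)) and H (l_2 (..), ..); so Q has
    negligible values and vanishes when one argument is negligible. Then
    H (Q (..), ..) = 0 and Q (H (..), ..) = 0 term by term.

    Two technical points remain. The Richardson-Nijenhuis bracket is a sum over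
    unshuffles, which [sum_unshuffles] turns into a recursion over the list of
    arguments, each argument going either into the inner form or to the outer
    one; every general fact about the bracket is then an induction on lists.
    And the family of the eta^j is infinite, so that H is only a pointwise limit
    of finite sums; the facts about H used above are equalities between linear
    expressions, which pass to the limit ([vvform_lim], [tilde_limit_ind]). *)

(** * Unshuffles *)

Section Unshuffles.
Variable p : nat.
Implicit Types (i : 'I_p.+1) (sg : 'S_p).

Lemma bump_lt h k : (bump h k < h)%N = (k < h)%N.
Proof. by rewrite /bump; lia. Qed.

Lemma ltn_lift i (a b : 'I_p) : (lift i a < lift i b)%N = (a < b)%N.
Proof. by rewrite !ltnNge /= leq_bump2. Qed.

(** A permutation that takes the value 0 at i is determined by what it does on
    the other indices. *)
Lemma big_perm_lift (V : nmodType) i (G : 'S_p.+1 -> V) :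
  \sum_(sg : 'S_p.+1 | sg i == ord0) G sg =
  \sum_(sg : 'S_p) G (lift_perm i ord0 sg).
Proof.
pose del_at (sg : 'S_p.+1) (a : 'I_p) : 'I_p := odflt a (unlift (sg i) (sg (lift i a))).
have del_atK (sg : 'S_p.+1) a : lift (sg i) (del_at sg a) = sg (lift i a).
  rewrite /del_at; case: unliftP => [b ->|/perm_inj e] //=.
  by have := neq_lift i a; rewrite e eqxx.
have del_at_inj (sg : 'S_p.+1) : injective (del_at sg).
  move=> a b e; apply: (@lift_inj _ i); apply: (@perm_inj _ sg).
  by rewrite -!del_atK e.
rewrite (reindex (lift_perm i ord0)).
  by apply: eq_bigl => sg; rewrite lift_perm_id eqxx.
exists (fun sg : 'S_p.+1 => perm (@del_at_inj sg)) => [sg _|sg].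
  by apply/permP => a; rewrite permE /del_at lift_perm_lift lift_perm_id liftK.
rewrite inE => /eqP sgi; apply/permP => a.
case: (unliftP i a) => [b|] ->; last by rewrite lift_perm_id.
by rewrite lift_perm_lift -sgi permE del_atK.
Qed.

(** In an unshuffle the value 0 comes first in one of the two blocks, so that it
    is taken at index 0 or at index k; what remains is again an unshuffle. *)
Lemma unshuffle_lift k i sg : unshuffle k (lift_perm i ord0 sg) =
  [&& i == ord0, (0 < k)%N & unshuffle k.-1 sg] ||
  (i == k :> nat) && unshuffle k sg.
Proof.
apply/idP/idP.
  move=> /forallP U; have {}U (a b : 'I_p.+1) : (a < b)%N -> (b < k)%N || (k <= a)%N ->
      (lift_perm i ord0 sg a < lift_perm i ord0 sg b)%N.
    by move=> ab h; have /forallP/(_ b)/implyP := U a; apply; rewrite ab.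
  have ik : (i == ord0) && (0 < k)%N || (i == k :> nat).
    case: (ltngtP i k) => ik; last by rewrite orbT.
    + rewrite orbF (leq_ltn_trans _ ik)// andbT; apply/negPn/negP => i0.
      have := U ord0 i; rewrite lift_perm_id ltn0 ik => h.
      by have : false by apply: h; rewrite ?lt0n.
    + have kp : (k < p.+1)%N := ltn_trans ik (ltn_ord i).
      have := U (Ordinal kp) i; rewrite lift_perm_id ltn0 /= ik leqnn orbT => h.
      by have : false by apply: h.
  have sub k' : (forall a b : 'I_p, (b < k')%N || (k' <= a)%N ->
      (lift i b < k)%N || (k <= lift i a)%N) -> unshuffle k' sg.
    move=> h; apply/forallP => a; apply/forallP => b; apply/implyP => /andP[ab bk].
    have := U (lift i a) (lift i b); rewrite !lift_perm_lift !ltn_lift.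
    by apply=> //; apply: h.
  apply/orP; case/orP: ik => [/andP[/eqP i0 k0]|/eqP ik].
    left; rewrite i0 k0 /=; apply: sub => a b; rewrite i0 /= /bump !add1n.
    by lia.
  right; rewrite ik eqxx /=; apply: sub => a b; rewrite /= /bump ik.
  by lia.
move=> H; apply/forallP => a; apply/forallP => b; apply/implyP => /andP[ab h].
case: (unliftP i b) => [b'|] eb; last first.
  (* the value 0 is taken at i, which starts the block that contains it *)
  move: H; rewrite eb in ab h; case/orP => [/and3P[/eqP i0]|/andP[/eqP ik]].
    by rewrite i0 in ab.
  by move: h; rewrite ik; lia.
case: (unliftP i a) => [a'|] ea; last first.
  by rewrite ea eb lift_perm_id lift_perm_lift.
rewrite ea eb !lift_perm_lift !ltn_lift in ab h *.
case/orP: H => [/and3P[/eqP i0 k0]|/andP[/eqP ik]] /forallP /(_ a') /forallP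
  /(_ b') /implyP; apply; rewrite ab /=; move: h.
  by rewrite i0 /= /bump; lia.
by rewrite /= /bump ik; lia.
Qed.

Lemma expfz_sum (F : fieldType) (I : Type) (r : seq I) (P : pred I)
    (f : I -> int) :
  ((-1) ^ (\sum_(i <- r | P i) f i) : F) = \prod_(i <- r | P i) (-1) ^ f i.
Proof.
elim/big_rec2: _ => [|a y z _ <-]; first exact: expr0z.
by rewrite expfzDr// oppr_eq0 oner_eq0.
Qed.

(** The inversions that involve the value 0, taken at i, are those with the
    indices before i: this is the sign of moving the first argument past the
    arguments that precede it after the permutation. *)
Lemma koszul_sign_lift (F : fieldType) (d : 'I_p.+1 -> int) i sg :
  koszul_sign F d (lift_perm i ord0 sg) =
  (-1) ^ (d ord0 * \sum_(a < p | (a < i)%N) d (lift ord0 (sg a))) *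
  koszul_sign F (d \o lift ord0) sg.
Proof.
rewrite /koszul_sign (bigD1_ord i)//= big1 ?mul1r; last first.
  by move=> b; rewrite lift_perm_id ltn0 andbF.
rewrite big_distrr /= expfz_sum [X in _ = X * _]big_mkcond -big_split /=.
apply: eq_bigr => a _; have [ai|ia] := ltnP a i.
  rewrite (bigD1_ord i) /= ?lift_perm_id ?lift_perm_lift; last first.
    by rewrite andbT bump_lt; exact: ai.
  rewrite (mulrC (d ord0)); congr (_ * _).
  apply: eq_big => b; rewrite lift_perm_lift //.
  by rewrite [(bump i a < _)%N]ltnNge leq_bump2 -ltnNge /= /bump !add1n ltnS.
rewrite mul1r big_mkcond (bigD1_ord i) //= ifF ?mul1r; last first.
  by rewrite bump_lt ltnNge; apply/negbTE/nandP; left; rewrite negbK; exact: ia.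
rewrite -big_mkcond /=; apply: eq_big => b; rewrite !lift_perm_lift //=.
by rewrite [(bump i a < _)%N]ltnNge leq_bump2 -ltnNge /= /bump !add1n ltnS.
Qed.

Lemma val_filter_enum n (P : pred nat) :
  [seq val a | a : 'I_n <- enum 'I_n & P a] = [seq a <- iota 0 n | P a].
Proof. by rewrite -val_enum_ord filter_map. Qed.

Lemma val_map_lift i (s : seq 'I_p) :
  map val (map (lift i) s) = map (bump i) (map val s).
Proof. by rewrite -!map_comp; apply: eq_map. Qed.

Lemma enum_lt_lift i : [seq a : 'I_p.+1 <- enum 'I_p.+1 | (a < i)%N] =
  [seq lift i a | a : 'I_p <- enum 'I_p & (a < i)%N].
Proof.
apply: (inj_map val_inj).
rewrite val_map_lift !(val_filter_enum _ (fun a => a < i)%N).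
have : (i <= p)%N by rewrite -ltnS.
move: (nat_of_ord i) => {i} i ip.
have {ip} -> : p = (i + (p - i))%N by lia.
move: (p - i)%N => q; rewrite -addnS !iotaD !filter_cat map_cat !add0n.
have -> : [seq a <- iota i q.+1 | (a < i)%N] = [::].
  apply/eqP; rewrite -[_ == _]negbK -has_filter; apply/hasPn => a.
  by rewrite mem_iota; lia.
have -> : [seq a <- iota i q | (a < i)%N] = [::].
  apply/eqP; rewrite -[_ == _]negbK -has_filter; apply/hasPn => a.
  by rewrite mem_iota; lia.
rewrite !cats0 -[LHS]map_id; apply/eq_in_map => a.
by rewrite mem_filter /bump; lia.
Qed.

Lemma enum_ge_lift i : [seq a : 'I_p.+1 <- enum 'I_p.+1 | (i <= a)%N] =
  i :: [seq lift i a | a : 'I_p <- enum 'I_p & (i <= a)%N].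
Proof.
apply: (inj_map val_inj).
rewrite [RHS]/= val_map_lift !(val_filter_enum _ (fun a => i <= a)%N).
have : (i <= p)%N by rewrite -ltnS.
move: (nat_of_ord i) => {i} i ip.
have {ip} -> : p = (i + (p - i))%N by lia.
move: (p - i)%N => q; rewrite -addnS !iotaD !filter_cat map_cat !add0n.
have -> : [seq a <- iota 0 i | (i <= a)%N] = [::].
  apply/eqP; rewrite -[_ == _]negbK -has_filter; apply/hasPn => a.
  by rewrite mem_iota; lia.
rewrite /= leqnn; congr (_ :: _).
have all_ge m : (i <= m)%N -> [seq a <- iota m q | (i <= a)%N] = iota m q.
  by move=> im; apply/all_filterP/allP => a; rewrite mem_iota; lia.
rewrite !all_ge // (@iotaDl 1 i); apply/eq_in_map => a.
by rewrite mem_iota /bump; lia.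
Qed.

Lemma enum_lt_lift0 k : [seq a : 'I_p.+1 <- enum 'I_p.+1 | (a < k.+1)%N] =
  ord0 :: [seq lift ord0 a | a : 'I_p <- enum 'I_p & (a < k)%N].
Proof. by rewrite enum_ordSl /= filter_map. Qed.

Lemma enum_ge_lift0 k : [seq a : 'I_p.+1 <- enum 'I_p.+1 | (k < a)%N] =
  [seq lift ord0 a | a : 'I_p <- enum 'I_p & (k <= a)%N].
Proof. by rewrite enum_ordSl /= filter_map. Qed.

End Unshuffles.

Section Splittings.
Variables (F : fieldType) (E : gradedSpace F).
Local Notation T := (int * E)%type.
Implicit Types (Phi Psi : seq T -> seq T -> E) (t l r : seq T).

Definition deg t : int := \sum_(u <- t) u.1.

(** The signed sum of Phi over all ways to distribute a list into a left and a
    right part; the head x of the list gets a sign when it goes to the right, for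
    it then jumps over the left part. *)
Fixpoint splits Phi t {struct t} : E :=
  if t is x :: t' then
    splits (fun l r => Phi (x :: l) r) t' +
    splits (fun l r => (-1) ^ (x.1 * deg l) *: Phi l (x :: r)) t'
  else Phi [::] [::].

Lemma eq_splits Phi Psi t : (forall l r, perm_eq (l ++ r) t -> Phi l r = Psi l r) ->
  splits Phi t = splits Psi t.
Proof.
elim: t Phi Psi => [|x t IH] Phi Psi e /=; first exact: e.
congr (_ + _); apply: IH => l r lr; first by apply: e; rewrite /= perm_cons.
by rewrite e// (perm_catCA l [:: x] r) /= perm_cons.
Qed.

(** Unshuffles of all types together choose an arbitrary left part. By
    [unshuffle_lift] and [koszul_sign_lift] the position of the first argument
    splits the sum in two, in the same way as the recursion of [splits]. *)
Lemma sum_unshuffles Phi p (X : 'I_p -> T) :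
  \sum_(k < p.+1) \sum_(sg : 'S_p | unshuffle k sg)
    koszul_sign F (fun i => (X i).1) sg *:
      Phi [seq X (sg i) | i : 'I_p <- enum 'I_p & (i < k)%N]
          [seq X (sg i) | i : 'I_p <- enum 'I_p & (k <= i)%N] =
  splits Phi [seq X i | i <- enum 'I_p].
Proof.
elim: p X Phi => [|p IH] X Phi.
  rewrite big_ord_recl big_ord0 addr0 (bigD1 1%g) /=; last first.
    by apply/forallP => -[].
  rewrite big1 => [|sg /andP[_ /negP[]]]; last by apply/eqP/permP => -[].
  by rewrite /koszul_sign big_ord0 scale1r addr0 (size0nil (size_enum_ord 0)).
pose term k (sg : 'S_p.+1) := koszul_sign F (fun i => (X i).1) sg *:
      Phi [seq X (sg i) | i : 'I_p.+1 <- enum 'I_p.+1 & (i < k)%N]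
          [seq X (sg i) | i : 'I_p.+1 <- enum 'I_p.+1 & (k <= i)%N].
(* group the permutations by the index i at which they take the value 0 *)
transitivity (\sum_(k < p.+2) \sum_(i < p.+1) \sum_(sg : 'S_p)
   ((if [&& i == ord0, (0 < k)%N & unshuffle k.-1 sg] then
      term k (lift_perm i ord0 sg) else 0) +
    (if (i == k :> nat) && unshuffle k sg then
      term k (lift_perm i ord0 sg) else 0))).
  apply: eq_bigr => k _; rewrite (partition_big (fun sg : 'S_p.+1 => sg^-1%g ord0) xpredT)//=.
  apply: eq_bigr => i _.
  rewrite (eq_bigl (fun sg : 'S_p.+1 => (sg i == ord0) && unshuffle k sg)); last first.
    move=> sg; rewrite andbC; congr (_ && _).
    by rewrite -(inj_eq (@perm_inj _ sg)) permKV eq_sym.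
  rewrite big_mkcondr big_perm_lift; apply: eq_bigr => sg _.
  rewrite unshuffle_lift -/(term k _).
  case: (boolP [&& _, _ & _]) => [/and3P[/eqP-> k0 _]|_] /=; last by rewrite add0r.
  by rewrite [0%N == _]eq_sym eqn0Ngt k0 addr0.
under eq_bigr => k _ do under eq_bigr => i _ do rewrite big_split.
under eq_bigr => k _ do rewrite big_split.
rewrite big_split enum_ordSl /= -map_comp -!(IH (X \o lift ord0)); congr (_ + _).
  rewrite big_ord_recl big1 ?add0r; last first.
    by move=> i _; rewrite big1// => sg _; rewrite andbF.
  apply: eq_bigr => k _; rewrite big_ord_recl /= [X in _ + X]big1 ?addr0; last first.
    by move=> i _; rewrite big1.
  rewrite [RHS]big_mkcond; apply: eq_bigr => sg _; rewrite add0n; case: ifP => // _.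
  rewrite /term koszul_sign_lift big_pred0 // mulr0 expr0z mul1r; congr (_ *: _).
  rewrite enum_lt_lift0 enum_ge_lift0 /= -!map_comp lift_perm_id.
  by congr (Phi (_ :: _) _); apply: eq_map => a /=; rewrite lift_perm_lift.
rewrite exchange_big; apply: eq_bigr => i _ /=.
rewrite (bigD1 (widen_ord (leqnSn _) i)) //= [X in _ + X]big1 ?addr0; last first.
  move=> k ki; rewrite big1// => sg _; rewrite ifF//; apply/negbTE.
  by rewrite negb_and; apply/orP; left; apply: contra ki => /eqP e; apply/eqP/val_inj.
rewrite [RHS]big_mkcond; apply: eq_bigr => sg _; rewrite eqxx andTb; case: ifP => // _.
rewrite /term koszul_sign_lift [X in X *: _ = _]mulrC -scalerA; congr (_ *: _).
rewrite enum_lt_lift enum_ge_lift /= -!map_comp lift_perm_id /deg; congr (_ *: Phi _ (_ :: _)).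
- by congr (_ ^ (_ * _)); rewrite big_map big_filter big_enum_cond.
- by apply: eq_map => a /=; rewrite lift_perm_lift.
- by apply: eq_map => a /=; rewrite lift_perm_lift.
Qed.

Lemma splits_lin (c : F) Phi Phi1 Phi2 t :
  (forall l r, Phi l r = c *: Phi1 l r + Phi2 l r) ->
  splits Phi t = c *: splits Phi1 t + splits Phi2 t.
Proof.
elim: t Phi Phi1 Phi2 => [|x t IH] Phi Phi1 Phi2 e /=; first exact: e.
rewrite scalerDr addrACA; congr (_ + _); apply: IH => l r; rewrite e//.
by rewrite scalerDr !scalerA mulrC.
Qed.

Lemma splits_ind (P : E -> Prop) Phi t : P 0 -> (forall x y, P x -> P y -> P (x + y)) ->
  (forall c x, P x -> P (c *: x)) ->
  (forall l r, perm_eq (l ++ r) t -> P (Phi l r)) -> P (splits Phi t).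
Proof.
move=> P0 PD PZ; elim: t Phi => [|x t IH] Phi e /=; first exact: e.
apply: PD; apply: IH => l r lr; first by apply: e; rewrite /= perm_cons.
by apply/PZ/e; rewrite (perm_catCA l [:: x] r) /= perm_cons.
Qed.

Lemma splits0 Phi t : (forall l r, Phi l r = 0) -> splits Phi t = 0.
Proof.
move=> e; apply: (@splits_ind (fun x => x = 0)) => //.
- by move=> x y -> ->; rewrite addr0.
- by move=> c x ->; rewrite scaler0.
Qed.

Lemma splits_nil_l Phi t : (forall x l r, Phi (x :: l) r = 0) ->
  splits Phi t = Phi [::] t.
Proof.
elim: t Phi => [//|x t IH] Phi e /=; rewrite splits0// add0r IH.
  by rewrite /deg big_nil mulr0 expr0z scale1r.
by move=> y l r; rewrite e scaler0.
Qed.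

Lemma splits_nil_r Phi t : (forall l x r, Phi l (x :: r) = 0) ->
  splits Phi t = Phi t [::].
Proof.
elim: t Phi => [//|x t IH] Phi e /=; rewrite [X in _ + X]splits0 ?addr0 ?IH//.
by move=> l r; rewrite e scaler0.
Qed.

Lemma deg_cat l r : deg (l ++ r) = deg l + deg r.
Proof. exact: big_cat. Qed.

Lemma deg_cons x t : deg (x :: t) = x.1 + deg t.
Proof. exact: big_cons. Qed.

Lemma perm_deg l r : perm_eq l r -> deg l = deg r.
Proof. exact: perm_big. Qed.

Lemma exprzN1D (a b : int) : ((-1) ^ (a + b) : F) = (-1) ^ a * (-1) ^ b.
Proof. by rewrite expfzDr// oppr_eq0 oner_eq0. Qed.

Lemma exprzN1_sqr (a : int) : ((-1) ^ a * (-1) ^ a : F) = 1.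
Proof. by rewrite -expfzMl mulrNN mulr1 exp1rz. Qed.

(** * Multilinear maps on a graded space *)

(** [multilin] and [graded_sym] are isolated from [is_vvform] because they are
    inherited by the maps K (x :: .) on which inductions on lists rely, whereas
    such a map is a form of a given degree only for homogeneous x. *)
Definition multilin (K : seq E -> E) : Prop := forall s1 (c : F) x y s2,
  K (s1 ++ (c *: x + y) :: s2) = c *: K (s1 ++ x :: s2) + K (s1 ++ y :: s2).

Definition graded_sym (K : seq E -> E) : Prop := forall s1 i x j y s2,
  homogeneous i x -> homogeneous j y ->
  K (s1 ++ x :: y :: s2) = (-1) ^ (i * j) *: K (s1 ++ y :: x :: s2).

(** The same two properties for the functions of lists of pairs (degree, element)
    that [mlext] takes as arguments. *)
Definition pmultilin (G : seq T -> E) : Prop := forall t1 i (c : F) x y t2,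
  G (t1 ++ (i, c *: x + y) :: t2) = c *: G (t1 ++ (i, x) :: t2) + G (t1 ++ (i, y) :: t2).

Definition pgraded_sym (G : seq T -> E) : Prop := forall t1 i x j y t2,
  homogeneous i x -> homogeneous j y ->
  G (t1 ++ (i, x) :: (j, y) :: t2) = (-1) ^ (i * j) *: G (t1 ++ (j, y) :: (i, x) :: t2).

Lemma splits_multilin Phi : (forall l, pmultilin (Phi l)) ->
  (forall r, pmultilin (fun l => Phi l r)) -> pmultilin (splits Phi).
Proof.
move=> + + t1; elim: t1 Phi => [|z t1 IH] Phi hr hl i c x y t2 /=.
  rewrite scalerDr addrACA; congr (_ + _); apply: splits_lin => l r.
    exact: (hl r [::]).
  by rewrite (hr l [::]) scalerDr !scalerA mulrC.
rewrite scalerDr addrACA; congr (_ + _); apply: IH => [l|r] t3 j d u v t4.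
- exact: hr.
- exact: (hl r (z :: t3)).
- by rewrite (hr l (z :: t3)) scalerDr !scalerA mulrC.
- by rewrite !deg_cat !deg_cons /= hl scalerDr !scalerA mulrC.
Qed.

Lemma splits_sym Phi : (forall l, pgraded_sym (Phi l)) ->
  (forall r, pgraded_sym (fun l => Phi l r)) -> pgraded_sym (splits Phi).
Proof.
move=> + + t1; elim: t1 Phi => [|z t1 IH] Phi hr hl i x j y t2 hx hy /=.
  have splitsZ c Psi t : c *: splits Psi t = splits (fun l r => c *: Psi l r) t.
    rewrite -[LHS]addr0 -[X in _ + X](@splits0 (fun _ _ => 0) t)//.
    by apply/esym/splits_lin => l r; rewrite addr0.
  (* x and y go both to the left, to opposite sides, or both to the right *)
  rewrite !scalerDr !splitsZ [RHS]addrACA; congr (_ + _ + (_ + _)).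
  - by apply: eq_splits => l r _; exact: (hl r [::]).
  - apply: eq_splits => l r _ /=; rewrite scalerA deg_cons /= mulrDr exprzN1D.
    by rewrite (mulrC j i) mulrA exprzN1_sqr mul1r.
  - by apply: eq_splits => l r _ /=; rewrite deg_cons /= mulrDr exprzN1D scalerA.
  - apply: eq_splits => l r _ /=; rewrite (hr l [::])// !scalerA.
    by congr (_ *: _); ring.
rewrite scalerDr; congr (_ + _); apply: (IH _ _ _ i x j y t2 hx hy) => [l|r] t3 k u l' v t4 hu hv.
- exact: hr.
- exact: (hl r (z :: t3)).
- by rewrite (hr l (z :: t3))// !scalerA mulrC.
- rewrite !deg_cat !deg_cons /= hl// !scalerA mulrC.
  by congr (_ * _ ^ (_ * _) *: _); ring.
Qed.

Lemma gpart0 i : gpart i (0 : E) = 0.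
Proof.
have := gpart_linear i (-1) (0 : E) 0.
by rewrite scaler0 addr0 scaleN1r addNr.
Qed.

Lemma gpartD i (x y : E) : gpart i (x + y) = gpart i x + gpart i y.
Proof. by have := gpart_linear i 1 x y; rewrite !scale1r. Qed.

Lemma gpartZ i c (x : E) : gpart i (c *: x) = c *: gpart i x.
Proof. by have := gpart_linear i c x 0; rewrite gpart0 !addr0. Qed.

Lemma homogeneous_gpart i (x : E) : homogeneous i (gpart i x).
Proof. by rewrite /homogeneous gpart_part eqxx. Qed.

Lemma homogeneous0 i : homogeneous i (0 : E). Proof. exact: gpart0. Qed.
Lemma homogeneousD i (x y : E) :
  homogeneous i x -> homogeneous i y -> homogeneous i (x + y).
Proof. by rewrite /homogeneous gpartD => -> ->. Qed.
Lemma homogeneousZ i c (x : E) : homogeneous i x -> homogeneous i (c *: x).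
Proof. by rewrite /homogeneous gpartZ => ->. Qed.

Lemma gpart_homogeneous i j (x : E) :
  homogeneous i x -> gpart j x = if j == i then x else 0.
Proof. by move=> <-; rewrite gpart_part; case: eqVneq => [->|]. Qed.

Lemma gpart_notin i (x : E) : i \notin gsupp x -> gpart i x = 0.
Proof.
move=> ix; rewrite {1}[x]gpart_sum (big_morph _ (gpartD i) (gpart0 i)).
rewrite big1_seq// => j /andP[_ jx]; rewrite gpart_part ifF//.
by apply: contraNF ix => /eqP ->.
Qed.

Lemma lin0 (f : E -> E) : (forall c x y, f (c *: x + y) = c *: f x + f y) -> f 0 = 0.
Proof. by move=> h; have := h (-1) 0 0; rewrite scaler0 addr0 scaleN1r addNr. Qed.

(** The list [gsupp x] depends on x in an uncontrolled way; this allows all the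
    elements of an equation to be decomposed along a common list of degrees. *)
Lemma sum_gsupp (f : int -> E -> E) x (r : seq int) : (forall i, f i 0 = 0) ->
  uniq r -> {subset gsupp x <= r} ->
  \sum_(i <- gsupp x) f i (gpart i x) = \sum_(i <- r) f i (gpart i x).
Proof.
move=> f0 ur sr; rewrite [RHS](bigID (mem (gsupp x))) /= [X in _ + X]big1 ?addr0.
  rewrite -[RHS]big_filter; apply: perm_big; apply: uniq_perm.
  - exact: gsupp_uniq.
  - exact: filter_uniq.
  - by move=> i; rewrite mem_filter; case: (boolP (i \in _)) => // /sr ->.
by move=> i /gpart_notin ->.
Qed.

Lemma sum_gpart_lin (f : int -> E -> E) :
  (forall i c x y, f i (c *: x + y) = c *: f i x + f i y) ->
  forall c x y, \sum_(i <- gsupp (c *: x + y)) f i (gpart i (c *: x + y)) =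
    c *: \sum_(i <- gsupp x) f i (gpart i x) + \sum_(i <- gsupp y) f i (gpart i y).
Proof.
move=> fl c x y; have f0 i := lin0 (fl i).
pose r := undup (gsupp (c *: x + y) ++ gsupp x ++ gsupp y).
have ur : uniq r := undup_uniq _.
rewrite !(@sum_gsupp f _ r)//; last 3 first.
- by move=> i ix; rewrite mem_undup !mem_cat ix !orbT.
- by move=> i ix; rewrite mem_undup !mem_cat ix !orbT.
- by move=> i ix; rewrite mem_undup !mem_cat ix.
rewrite scaler_sumr -big_split; apply: eq_bigr => i _ /=.
by rewrite gpart_linear fl.
Qed.

Lemma sum_gpart_homogeneous (f : int -> E -> E) i x : (forall j, f j 0 = 0) ->
  homogeneous i x -> \sum_(j <- gsupp x) f j (gpart j x) = f i x.
Proof.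
move=> f0 hx; rewrite (@sum_gsupp f x (undup (i :: gsupp x))) ?undup_uniq//.
  rewrite (bigD1_seq i) ?undup_uniq ?mem_undup ?mem_head//= hx big1 ?addr0//.
  by move=> j ji; rewrite (gpart_homogeneous _ hx) (negbTE ji).
by move=> j jx; rewrite mem_undup in_cons jx orbT.
Qed.

Lemma mlext_linG (c : F) (G G1 G2 : seq T -> E) s :
  (forall t, G t = c *: G1 t + G2 t) -> mlext G s = c *: mlext G1 s + mlext G2 s.
Proof.
elim: s G G1 G2 => [|x s IH] G G1 G2 e /=; first exact: e.
rewrite scaler_sumr -big_split; apply: eq_bigr => i _ /=; exact: IH.
Qed.

Definition homogeneous_list t := forall u, u \in t -> homogeneous u.1 u.2.

Lemma homogeneous_cons i (x : E) t :
  homogeneous i x -> homogeneous_list t -> homogeneous_list ((i, x) :: t).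
Proof. by move=> hx ht u; rewrite in_cons => /orP[/eqP ->|/ht]. Qed.

Lemma eq_mlext (G1 G2 : seq T -> E) : (forall t, homogeneous_list t -> G1 t = G2 t) ->
  mlext G1 =1 mlext G2.
Proof.
move=> + s; elim: s G1 G2 => [|x s IH] G1 G2 e /=; first exact: e.
apply: eq_bigr => i _; apply: IH => t ht; apply/e/homogeneous_cons => //.
exact: homogeneous_gpart.
Qed.

Lemma pmultilin_cons (G : seq T -> E) u :
  pmultilin G -> pmultilin (fun t => G (u :: t)).
Proof. by move=> h t1; apply: (h (u :: t1)). Qed.

Lemma mlext_cons_lin (G : seq T -> E) s i c x y : pmultilin G ->
  mlext (fun t => G ((i, c *: x + y) :: t)) s =
  c *: mlext (fun t => G ((i, x) :: t)) s + mlext (fun t => G ((i, y) :: t)) s.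
Proof. by move=> h; apply: mlext_linG => t; apply: (h [::]). Qed.

Lemma mlext_multilin (G : seq T -> E) : pmultilin G -> multilin (mlext G).
Proof.
move=> + s1; elim: s1 G => [|z s1 IH] G h c x y s2 /=.
  pose f i v := mlext (fun t => G ((i, v) :: t)) s2.
  by apply: (@sum_gpart_lin f) => i d u v; apply: mlext_cons_lin.
rewrite scaler_sumr -big_split; apply: eq_bigr => i _ /=.
exact/IH/pmultilin_cons.
Qed.

Lemma mlext_homogeneous (G : seq T -> E) t : pmultilin G -> homogeneous_list t ->
  mlext G [seq u.2 | u <- t] = G t.
Proof.
elim: t G => [//|[i x] t IH] G h ht /=.
have hx : homogeneous i x by apply: (ht (i, x)); rewrite mem_head.
pose f j v := mlext (fun t' => G ((j, v) :: t')) [seq u.2 | u <- t].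
rewrite (@sum_gpart_homogeneous f i) // /f.
  rewrite IH//; first exact: pmultilin_cons.
  by move=> u ut; apply: ht; rewrite in_cons ut orbT.
by move=> j; apply: (@lin0 (f j)) => c u v; apply: mlext_cons_lin.
Qed.

Lemma multilin_cons (K : seq E -> E) x : multilin K -> multilin (fun s => K (x :: s)).
Proof. by move=> h s1; apply: (h (x :: s1)). Qed.

Lemma multilin_head0 (K : seq E -> E) s : multilin K -> K (0 :: s) = 0.
Proof. by move=> h; apply: (@lin0 (fun v => K (v :: s))) => c x y; apply: (h [::]). Qed.

Lemma multilin_sum_gpart (K : seq E -> E) x s : multilin K ->
  K (x :: s) = \sum_(i <- gsupp x) K (gpart i x :: s).
Proof.
move=> h; rewrite {1}[x]gpart_sum.
apply: (big_morph (fun v => K (v :: s))); last exact: multilin_head0.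
by move=> u v; have := h [::] 1 u v s; rewrite /= !scale1r.
Qed.

Lemma mlext_vals (K : seq E -> E) : multilin K ->
  mlext (fun t => K [seq u.2 | u <- t]) =1 K.
Proof.
move=> + s; elim: s K => [//|x s IH] K h /=.
rewrite [RHS]multilin_sum_gpart//; apply: eq_bigr => i _.
by rewrite -(IH _ (multilin_cons (gpart i x) h)).
Qed.

(** Identities between multilinear maps, such as those between brackets, need
    only be checked on homogeneous arguments, where [vv_ins] is given by
    [splits] ([vv_ins_homogeneous]). *)
Lemma multilin_ext (K L : seq E -> E) : multilin K -> multilin L ->
  (forall t, homogeneous_list t -> K [seq u.2 | u <- t] = L [seq u.2 | u <- t]) ->
  K =1 L.
Proof.
by move=> hK hL e s; rewrite -(mlext_vals hK) -(mlext_vals hL); apply: eq_mlext.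
Qed.

Lemma mlext_sym (G : seq T -> E) : pmultilin G -> pgraded_sym G -> graded_sym (mlext G).
Proof.
move=> + + s1; elim: s1 G => [|z s1 IH] G hm hs i x j y s2 hx hy /=; last first.
  rewrite scaler_sumr; apply: eq_bigr => k _; apply: IH => //.
    exact: pmultilin_cons.
  by move=> t1; apply: (hs (_ :: t1)).
pose f u := fun k v => mlext (fun t => G (u :: (k, v) :: t)) s2.
have fl u k c a b : f u k (c *: a + b) = c *: f u k a + f u k b.
  exact: (mlext_cons_lin s2 k c a b (pmultilin_cons u hm)).
have f0 u k : f u k 0 = 0 by apply: (lin0 (fl u k)).
have gl v k c a b : f (k, c *: a + b) v.1 v.2 = c *: f (k, a) v.1 v.2 + f (k, b) v.1 v.2.
  by apply: mlext_linG => t; apply: (hm [::]).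
have two (k q : int) (a b : E) : homogeneous k a -> homogeneous q b ->
   \sum_(i <- gsupp a) \sum_(j <- gsupp b) f (i, gpart i a) j (gpart j b) = f (k, a) q b.
  move=> ha hb.
  under eq_bigr => i' _ do rewrite (sum_gpart_homogeneous (f0 _) hb).
  apply: (@sum_gpart_homogeneous (fun i v => f (i, v) q b)) => // i'.
  by apply: (@lin0 (fun v => f (i', v) q b)); apply: (gl (q, b)).
rewrite (two i j x y)// (two j i y x)// /f.
rewrite -[RHS]addr0 -[X in _ + X](f0 (i, x) j); apply: mlext_linG => t.
have -> : G ((i, x) :: (j, 0) :: t) = 0.
  by apply: (@lin0 (fun v => G ((i, x) :: (j, v) :: t))) => c u v; apply: (hm [:: (i, x)]).
by rewrite addr0; apply: (hs [::]).
Qed.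

(** * Insertion of vector valued forms *)

Definition insertion (K L : seq E -> E) l r : E :=
  L (K [seq u.2 | u <- l] :: [seq u.2 | u <- r]).

Lemma vv_insE (K L : seq E -> E) s : vv_ins K L s = mlext (splits (insertion K L)) s.
Proof.
apply: eq_mlext => t _; have := sum_unshuffles (insertion K L) (tnth (in_tuple t)).
rewrite map_tnth_enum => <-.
apply: eq_bigr => k _; apply: eq_bigr => sg _.
by rewrite /insertion -!map_comp.
Qed.

Lemma insertion_multilin (K L : seq E -> E) : multilin K -> multilin L ->
  pmultilin (splits (insertion K L)).
Proof.
move=> hK hL; apply: splits_multilin => [l|r] t1 i c x y t2; rewrite /insertion.
  by rewrite !map_cat; apply: (hL (_ :: _)).
by rewrite !map_cat hK; apply: (hL [::]).
Qed.

Lemma insertion_sym (K L : seq E -> E) :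
  graded_sym K -> graded_sym L -> multilin L ->
  pgraded_sym (splits (insertion K L)).
Proof.
move=> sK sL mL; apply: splits_sym => [l|r] t1 i x j y t2 hx hy; rewrite /insertion.
  by rewrite !map_cat; apply: (sL (_ :: _)).
rewrite !map_cat /= (sK _ i x j y)// -[_ *: K _]addr0 (mL [::]) /=.
by rewrite multilin_head0// addr0.
Qed.

Lemma vv_ins_multilin (K L : seq E -> E) :
  multilin K -> multilin L -> multilin (vv_ins K L).
Proof.
move=> mK mL s1 c x y s2; rewrite !vv_insE.
exact/mlext_multilin/insertion_multilin.
Qed.

Lemma vv_ins_homogeneous (K L : seq E -> E) t : multilin K -> multilin L ->
  homogeneous_list t -> vv_ins K L [seq u.2 | u <- t] = splits (insertion K L) t.
Proof.
move=> mK mL ht; rewrite vv_insE mlext_homogeneous//; exact: insertion_multilin.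
Qed.

Lemma vv_ins_vvform dK dL (K L : seq E -> E) :
  is_vvform dK K -> is_vvform dL L -> is_vvform (dK + dL) (vv_ins K L).
Proof.
move=> [mK sK hK] [mL sL hL]; split.
- exact: vv_ins_multilin.
- move=> s1 i x j y s2 hx hy; rewrite !vv_insE; apply: mlext_sym => //.
    exact: insertion_multilin.
  exact: insertion_sym.
- move=> t ht; rewrite vv_ins_homogeneous//.
  apply: splits_ind => [|x y|c x|l r lr].
  + exact: homogeneous0.
  + exact: homogeneousD.
  + exact: homogeneousZ.
  have hlr u : u \in l ++ r -> homogeneous u.1 u.2.
    by rewrite (perm_mem lr) => /ht.
  have hl : homogeneous (deg l + dK) (K [seq u.2 | u <- l]).
    by apply: hK => u ul; apply: hlr; rewrite mem_cat ul.
  have := hL ((deg l + dK, K [seq u.2 | u <- l]) :: r).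
  rewrite -[\sum_(u <- t) _]/(deg t) -(perm_deg lr) deg_cat -/(deg _) deg_cons /=.
  have -> : deg l + dK + deg r + dL = deg l + deg r + (dK + dL) by ring.
  apply; apply: homogeneous_cons => // u ur.
  by apply: hlr; rewrite mem_cat ur orbT.
Qed.

Lemma vvformZ d c (K : seq E -> E) : is_vvform d K -> is_vvform d (fun s => c *: K s).
Proof.
move=> [mK sK hK]; split=> [s1 a x y s2|s1 i x j y s2 hx hy|t ht].
- by rewrite mK scalerDr !scalerA mulrC.
- by rewrite (sK _ i x j y)// !scalerA mulrC.
- exact/homogeneousZ/hK.
Qed.

Lemma vvformD d (K L : seq E -> E) :
  is_vvform d K -> is_vvform d L -> is_vvform d (fun s => K s + L s).
Proof.
move=> [mK sK hK] [mL sL hL]; split=> [s1 a x y s2|s1 i x j y s2 hx hy|t ht].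
- by rewrite mK mL scalerDr addrACA.
- by rewrite (sK _ i x j y)// (sL _ i x j y)// scalerDr.
- by apply: homogeneousD; [exact: hK | exact: hL].
Qed.

Lemma vvform0 d : is_vvform d (fun=> 0 : E).
Proof.
split=> [s1 a x y s2|s1 i x j y s2 _ _|t _]; rewrite ?scaler0 ?addr0//.
exact: homogeneous0.
Qed.

Lemma vvform_sum (I : eqType) (r : seq I) (K : I -> seq E -> E) d :
  (forall i, i \in r -> is_vvform d (K i)) ->
  is_vvform d (fun s => \sum_(i <- r) K i s).
Proof.
elim: r => [|i r IH] h.
  by under eq_fun do rewrite big_nil; exact: vvform0.
under eq_fun do rewrite big_cons; apply: vvformD; first exact/h/mem_head.
by apply: IH => j jr; apply: h; rewrite in_cons jr orbT.
Qed.

Lemma rn_bracket_vvform dK dL (K L : seq E -> E) : is_vvform dK K -> is_vvform dL L ->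
  is_vvform (dK + dL) (rn_bracket dK dL K L).
Proof.
move=> hK hL; apply: vvformD; first exact: vv_ins_vvform.
under eq_fun do rewrite -scaleN1r scalerA.
by apply: vvformZ; rewrite addrC; apply: vv_ins_vvform.
Qed.

Lemma vv_insDl (K1 K2 L : seq E -> E) : multilin L ->
  forall s, vv_ins (fun s => K1 s + K2 s) L s = vv_ins K1 L s + vv_ins K2 L s.
Proof.
move=> mL s; rewrite !vv_insE -[X in _ = X + _]scale1r; apply: mlext_linG => t.
apply: splits_lin => l r; rewrite /insertion -[K1 _]scale1r.
by rewrite (mL [::]) scale1r.
Qed.

Lemma vv_insDr (K L1 L2 : seq E -> E) s :
  vv_ins K (fun s => L1 s + L2 s) s = vv_ins K L1 s + vv_ins K L2 s.
Proof.
rewrite !vv_insE -[X in _ = X + _]scale1r; apply: mlext_linG => t.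
by apply: splits_lin => l r; rewrite /insertion scale1r.
Qed.

Lemma rn_bracketDl dK dL (K1 K2 L : seq E -> E) : multilin L ->
  forall s, rn_bracket dK dL (fun s => K1 s + K2 s) L s =
    rn_bracket dK dL K1 L s + rn_bracket dK dL K2 L s.
Proof.
by move=> mL s; rewrite /rn_bracket vv_insDl// vv_insDr scalerDr opprD addrACA.
Qed.

Lemma rn_bracketDr dK dL (K L1 L2 : seq E -> E) : multilin K ->
  forall s, rn_bracket dK dL K (fun s => L1 s + L2 s) s =
    rn_bracket dK dL K L1 s + rn_bracket dK dL K L2 s.
Proof.
by move=> mK s; rewrite /rn_bracket vv_insDr vv_insDl// scalerDr opprD addrACA.
Qed.

Definition homogeneous_parts (js : seq int) (s : seq E) : seq T :=
  [seq (u.1, gpart u.1 u.2) | u <- zip js s].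

Lemma mlext_ind (P : E -> Prop) (G : seq T -> E) s :
  P 0 -> (forall x y, P x -> P y -> P (x + y)) ->
  (forall js, size js = size s -> P (G (homogeneous_parts js s))) -> P (mlext G s).
Proof.
move=> P0 PD; elim: s G => [|x s IH] G h /=; first exact: (h [::]).
elim/big_ind: _ => // i _; apply: IH => js e.
by apply: (h (i :: js)); rewrite /= e.
Qed.

(** A property of the values of [vv_ins] holds if it is linear and holds for each
    term. The lists l and r are made of the homogeneous components of the
    arguments, so that hypotheses on some argument can be used on them. *)
Lemma vv_ins_ind (P : E -> Prop) (K L : seq E -> E) s :
  P 0 -> (forall x y, P x -> P y -> P (x + y)) -> (forall c x, P x -> P (c *: x)) ->
  (forall js l r, size js = size s -> perm_eq (l ++ r) (homogeneous_parts js s) ->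
     P (insertion K L l r)) ->
  P (vv_ins K L s).
Proof.
move=> P0 PD PZ h; rewrite vv_insE; apply: mlext_ind => // js e.
by apply: splits_ind => // l r; apply: h.
Qed.

(** * Forms of the type S + H *)

Lemma euler_map_vvform : is_vvform 0 (@euler_map F E).
Proof.
have mS c (x y : E) : euler_map [:: c *: x + y] = c *: euler_map [:: x] + euler_map [:: y].
  apply: (@sum_gpart_lin (fun i v => (- i)%:~R *: v)) => i a u v.
  by rewrite scalerDr !scalerA mulrC.
split=> [s1 c x y s2|s1 i x j y s2 _ _|t ht].
- case: s1 => [|a [|b s1]] /=; last by rewrite scaler0 addr0.
    by case: s2 => [|b s2] /=; [exact: mS | rewrite scaler0 addr0].
  by rewrite scaler0 addr0.
- by case: s1 => [|a [|b s1]] /=; rewrite scaler0.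
- rewrite addr0; case: t ht => [|[i x] [|v t]] ht; try exact: homogeneous0.
  rewrite big_seq1 /= (@sum_gpart_homogeneous (fun i v => (- i)%:~R *: v) i).
  + by apply/homogeneousZ/(ht (i, x)); rewrite mem_head.
  + by move=> j; rewrite scaler0.
  + by apply: (ht (i, x)); rewrite mem_head.
Qed.

(* keeps euler_map [:: x] folded, in the form that euler_map1 rewrites *)
Local Arguments euler_map F E s : simpl never.

Lemma euler_map1 i (x : E) : homogeneous i x -> euler_map [:: x] = (- i)%:~R *: x.
Proof.
move=> hx; apply: (@sum_gpart_homogeneous (fun i v => (- i)%:~R *: v)) => // j.
by rewrite scaler0.
Qed.

(** Only the splittings with a single argument y on the left contribute. Moving
    S y back to its place by symmetry absorbs the Koszul sign and leaves minus
    the degree of y. *)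
Lemma insert_euler (L : seq E -> E) t : multilin L -> graded_sym L ->
  homogeneous_list t ->
  splits (insertion (@euler_map F E) L) t = (- deg t)%:~R *: L [seq u.2 | u <- t].
Proof.
elim: t L => [|[i x] t IH] L mL sL ht.
  by rewrite /= /insertion /= multilin_head0// /deg big_nil oppr0 scale0r.
have hx : homogeneous i x by apply: (ht (i, x)); rewrite mem_head.
have ht' : homogeneous_list t.
  by move=> u ut; apply: ht; rewrite in_cons ut orbT.
rewrite deg_cons opprD intrD scalerDl /=; congr (_ + _).
  rewrite splits_nil_l; last first.
    by move=> u l r; rewrite /insertion /= multilin_head0.
  rewrite /insertion /= (euler_map1 hx) -[_ *: x]addr0 (mL [::]) /=.
  by rewrite multilin_head0// addr0.
rewrite -(IH (fun s => L (x :: s))); last 3 first.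
- exact: multilin_cons.
- by move=> s1; apply: (sL (x :: s1)).
- by [].
apply: eq_splits => l r lr; rewrite /insertion /=.
have L0 s : L [:: x, 0 & s] = 0 := multilin_head0 s (multilin_cons x mL).
case: l lr => [|[j y] [|v l]] lr /=; last 1 first.
- by rewrite -[euler_map _]/(0 : E) L0 multilin_head0// scaler0.
- by rewrite -[euler_map _]/(0 : E) L0 multilin_head0// scaler0.
have hy : homogeneous j y.
  by apply: (ht' (j, y)); rewrite -(perm_mem lr) mem_head.
have hSy : homogeneous j (euler_map [:: y]).
  by rewrite (euler_map1 hy); apply: homogeneousZ.
by rewrite (sL [::] i x j (euler_map [:: y]))// deg_cons /deg big_nil addr0.
Qed.

(** The difference between minus the total degree of the arguments and minus the
    degree of the value is the degree of L. *)
Lemma rn_bracket_euler d (L : seq E -> E) : is_vvform d L ->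
  rn_bracket 0 d (@euler_map F E) L =1 fun s => d%:~R *: L s.
Proof.
move=> hL; have [mL sL dL] := hL; have [mS _ _] := euler_map_vvform.
have [mB _ _] := rn_bracket_vvform euler_map_vvform hL.
have [mdL _ _] := vvformZ d%:~R hL.
apply: multilin_ext => // t ht; rewrite /rn_bracket mul0r expr0z scale1r.
rewrite !vv_ins_homogeneous// insert_euler// splits_nil_r; last first.
  by move=> l u r; rewrite /insertion.
rewrite /insertion /= (euler_map1 (dL t ht)) -scalerBl -intrB.
by congr (_%:~R *: _); rewrite /deg; ring.
Qed.

(** The second form is K = S + 2 H: since S acts on forms by their degree, both
    sides of the first condition are mu + 2 [H, mu]. *)
Lemma euler_add_nijenhuis (mu H N : seq E -> E) :
  is_vvform 1 mu -> is_vvform 0 H ->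
  rn_bracket 0 1 H (rn_bracket 0 1 H mu) =1 (fun=> 0) ->
  N =1 (fun s => euler_map s + H s) -> nijenhuis mu N.
Proof.
move=> hmu hH HHmu /funext ->; have hS := euler_map_vvform.
have hN := vvformD hS hH; have hK := vvformD hN hH.
have [mmu _ _] := hmu; have [mH _ _] := hH; have [mN _ _] := hN.
have hQ := rn_bracket_vvform hH hmu; have [mQ _ _] := hQ; rewrite add0r in hQ.
have [mS _ _] := hS; have [mK _ _] := hK.
split=> //; exists (fun s => euler_map s + H s + H s) => //; split=> s.
  have -> : rn_bracket 0 1 (fun s => euler_map s + H s) mu =
      (fun s => mu s + rn_bracket 0 1 H mu s).
    by apply/funext => s'; rewrite rn_bracketDl// (rn_bracket_euler hmu) scale1r.
  rewrite rn_bracketDr// !rn_bracketDl// (rn_bracket_euler hmu) (rn_bracket_euler hQ).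
  by rewrite HHmu addr0 !scale1r.
have HH : rn_bracket 0 0 H H s = 0 by rewrite /rn_bracket mulr0 expr0z scale1r subrr.
have HS : rn_bracket 0 0 H (@euler_map F E) s = 0.
  have := rn_bracket_euler hH s; rewrite /rn_bracket mulr0 expr0z !scale1r scale0r.
  by move=> /eqP; rewrite subr_eq0 => /eqP ->; rewrite subrr.
rewrite rn_bracketDl// !rn_bracketDr// !(rn_bracket_euler hH) (rn_bracket_euler hS).
by rewrite HH HS !scale0r !addr0.
Qed.

End Splittings.
(** * The Lie n-algebra of an n-plectic manifold *)

Section Associated.
Variables (R : realType) (m : nat) (M : smoothManifold R m) (n : nat).
Variable w : nplectic M n.
Local Notation contract := Defs.contract.
Local Notation AE := (assocE w).
Local Notation E := (assoc_graded w).
Local Notation hams s := [seq ham_vf x | x <- s].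
Implicit Types (x y z : AE) (s : seq AE) (al be : dform M) (Y : seq (vfield M)).

Lemma assoc_linE c x y Y : (c *: x + y) Y = c *: (x Y : Cinf M) + y Y.
Proof. by []. Qed.

Lemma dform_scaleE c al Y : (c *: al) Y = c *: (al Y : Cinf M).
Proof. by []. Qed.

Lemma Cinf_scaleE c (f : Cinf M) : (c *: (1 : Cinf M)) * f = c *: f.
Proof. by rewrite -Cinf_scaleAl mul1r. Qed.

Lemma contractE Xs al Y : contract Xs al Y = al (rev Xs ++ Y).
Proof.
elim: Xs Y => [//|X Xs IH] Y /=.
by rewrite rev_cons cat_rcons -IH.
Qed.

Lemma contract_lin (s1 s2 : seq (vfield M)) (c : R) X X' al Y :
  contract (s1 ++ ((c *: (1 : Cinf M)) *: X + X') :: s2) al Y =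
  c *: (contract (s1 ++ X :: s2) al Y : Cinf M) + contract (s1 ++ X' :: s2) al Y.
Proof.
have [am _] := dformP al.
by rewrite !contractE !rev_cat !rev_cons !cat_rcons -!catA /= am Cinf_scaleE.
Qed.

Lemma contract_alt (s1 s2 : seq (vfield M)) X X' al Y :
  contract (s1 ++ X :: X' :: s2) al Y = - contract (s1 ++ X' :: X :: s2) al Y.
Proof.
have [_ aa] := dformP al.
by rewrite !contractE !rev_cat !rev_cons !cat_rcons -!catA /= aa.
Qed.

Lemma contract0 Xs al : 0 \in Xs -> contract Xs al = 0.
Proof.
move=> /path.splitPr [s1 s2]; apply: dform_ext => Y.
have := contract_lin s1 s2 (-1) 0 0 al Y.
by rewrite scaler0 addr0 scaleN1r addNr.
Qed.

(** By non-degeneracy, a Hamiltonian vector field may be recognized by its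
    defining equation. *)
Lemma ham_vf_lin c x y :
  ham_vf (c *: x + y) = (c *: (1 : Cinf M)) *: ham_vf x + ham_vf y.
Proof.
apply: (hamiltonian_unique (ham_vfP _)); rewrite /hamiltonian_for /=.
rewrite form_part_linear ext_dD ext_dZ iprod_add iprod_scale opprD -scalerN.
by congr (_ *: _ + _); exact: ham_vfP.
Qed.

Lemma ham_vf_part0 x : assoc_part (-1) x = 0 -> ham_vf x = 0.
Proof.
move=> x0; apply: (hamiltonian_unique (ham_vfP _)).
by rewrite x0 /hamiltonian_for /= ext_d0 iprod0 oppr0.
Qed.

Lemma ham_vf0 : ham_vf (0 : AE) = 0.
Proof. by apply: ham_vf_part0; apply: val_inj; exact: form_part0. Qed.

Lemma ham_vf_part i x : ham_vf x = 0 -> ham_vf (assoc_part i x) = 0.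
Proof.
move=> hx; rewrite /ham_vf assoc_part_part; case: eqVneq => [_|_]; first exact: hx.
by have := ham_vf0; rewrite /ham_vf; congr (xget _ (hamiltonian_for _ _) = _); apply: form_part0.
Qed.

Lemma ham_vf_homogeneous i x : homogeneous (E := E) i x -> i != -1 -> ham_vf x = 0.
Proof.
move=> hx i1; apply: ham_vf_part0; rewrite -hx /= assoc_part_part.
by rewrite eq_sym (negbTE i1).
Qed.

Lemma contract_ham0 x s al : x \in s -> ham_vf x = 0 -> contract (hams s) al = 0.
Proof. by move=> xs hx; apply: contract0; rewrite -hx; apply: map_f. Qed.

(** The common shape of the brackets l_k for k >= 2 (al = w) and of the
    contractions [eta_tilde] (al = eta), up to a scalar for each arity. *)
Definition contraction_form (c : nat -> R) al (K : seq AE -> AE) : Prop :=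
  forall s Y, K s Y =
    (if (1 < size s)%N then c (size s) *: (contract (hams s) al Y : Cinf M) else 0).

(** Symmetry: on degree -1 the graded sign is -1, which is the alternation of al;
    in other degrees both sides vanish, and for the same reason only degree -1
    matters for the degree of K. *)
Lemma contraction_vvform (d : int) c al (K : seq AE -> AE) :
  is_kform (n%:Z + d) al -> contraction_form c al K -> is_vvform (E := E) d K.
Proof.
move=> hal hK; split.
- move=> s1 a x y s2; apply: assoc_ext => Y.
  rewrite assoc_linE !hK !size_cat /=; case: ifP => _; last by rewrite scaler0 addr0.
  rewrite !map_cat /= ham_vf_lin.
  rewrite contract_lin scalerDr !scalerA mulrC //.
- move=> s1 i x j y s2 hx hy; apply: assoc_ext => Y.
  rewrite dform_scaleE !hK !size_cat /=; case: ifP => _; last by rewrite scaler0.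
  case: (boolP ((i == -1) && (j == -1))) => [/andP[/eqP-> /eqP->]|].
    by rewrite !map_cat /= contract_alt scaleN1r scalerN.
  have v z s : z \in s -> ham_vf z = 0 -> contract (hams s) al Y = 0.
    by move=> zs hz; rewrite (contract_ham0 _ zs).
  rewrite negb_and => /orP[i1|j1].
    by rewrite !(v x) ?scaler0 ?(ham_vf_homogeneous hx)// mem_cat !inE eqxx ?orbT.
  by rewrite !(v y) ?scaler0 ?(ham_vf_homogeneous hy)// mem_cat !inE eqxx ?orbT.
- move=> t ht; rewrite /homogeneous; apply: assoc_ext => Y.
  rewrite [LHS]form_partE hK size_map; case: ifP => // /negbT sY.
  case: ifP => // _; case: (boolP (all (fun u => u.1 == -1) t)) => [/allP t1|].
    have st : \sum_(u <- t) u.1 = - (size t)%:Z.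
      elim: t t1 {ht sY} => [|u t IH] t1; first by rewrite big_nil.
      rewrite big_cons (eqP (t1 u (mem_head _ _))) IH /=; first by lia.
      by move=> v vt; apply: t1; rewrite in_cons vt orbT.
    rewrite (kform_contract hal) ?scaler0// !size_map.
    by apply: contra sY; rewrite st => /eqP ->; apply/eqP; lia.
  case/allPn => u ut u1; rewrite (@contract_ham0 u.2) ?scaler0//.
    exact: map_f.
  exact: (ham_vf_homogeneous (ht u ut)).
Qed.

Definition l1_map s : AE := if s is [:: x] then to_assoc w (l1_form x) else 0.
Definition lk_map s : AE := if (1 < size s)%N then to_assoc w (lk_form s) else 0.

(** The brackets l_k stop at k = n + 1 in [assoc_mu] but not in [lk_map]; a
    contraction of w by more than n + 1 fields is zero anyway. *)
Lemma assoc_muE : (0 < n)%N -> @assoc_mu _ _ _ _ w =1 (fun s => l1_map s + lk_map s).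
Proof.
move=> n0 s; rewrite /assoc_mu.
have [s0|s0] := posnP (size s).
  rewrite (size0nil s0) /l1_map /lk_map /= addr0 big_nat big1// => k /andP[k0 _].
  by rewrite /assoc_l /= ifT// eq_sym -lt0n.
have [sn|sn] := ltnP (size s) n.+2.
  rewrite (bigD1_seq (size s)) ?mem_index_iota ?iota_uniq ?s0//= big1 ?addr0; last first.
    by move=> k ks; rewrite /assoc_l eq_sym ks.
  rewrite /assoc_l eqxx /=.
  by case: s s0 {sn} => [|x [|y s]] // _; rewrite /l1_map /lk_map /= ?addr0 ?add0r.
rewrite big_nat big1 => [|k /andP[_ kn]]; last first.
  by rewrite /assoc_l ifT// neq_ltn (leq_trans kn sn) orbT.
have s1 : (1 < size s)%N by apply: leq_trans sn.
have -> : l1_map s = 0 by move: s1; case: s {s0 sn} => [|x [|]].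
rewrite add0r; apply: assoc_ext => Y; rewrite /lk_map s1 to_assocE; last exact: lk_in.
have ck := @kform_contract _ _ M _ (hams s) _ (@nplectic_kform _ _ _ _ w).
rewrite /lk_form dform_scaleE ck ?scaler0// size_map; apply/eqP; lia.
Qed.

Lemma l1_form_lin c x y : l1_form (c *: x + y) = c *: l1_form x + l1_form y.
Proof.
rewrite /l1_form scaler_sumr -big_split; apply: eq_bigr => i _ /=.
by rewrite form_part_linear ext_dD ext_dZ scalerDr !scalerA mulrC.
Qed.

Lemma l1_map_vvform : is_vvform (E := E) 1 l1_map.
Proof.
split.
- case=> [|a [|b s1]] c x y [|z s2] /=; rewrite ?scaler0 ?addr0//.
  apply: assoc_ext => Y; by rewrite assoc_linE !(to_assocE (l1_in _)) l1_form_lin.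
- by case=> [|a s1] i x j y s2 _ _ /=; rewrite ?scaler0//; case: s1 => [|b s1] /=; rewrite scaler0.
- case=> [|[i x] [|v t]] ht; try exact: homogeneous0.
  have hx : homogeneous (E := E) i x by apply: (ht (i, x)); rewrite mem_head.
  rewrite big_seq1 /homogeneous; apply: val_inj => /=.
  rewrite to_assocE; last exact: l1_in.
  have K : is_kform (n%:Z + (i + 1)) (l1_form x).
    rewrite /l1_form; elim/big_ind: _ => // [a b ha hb Y hY|j _ Y hY].
      by have -> : (a + b) Y = a Y + b Y by []; rewrite ha// hb// addr0.
    have xj : assoc_part j x = if j == i then x else 0 := gpart_homogeneous j hx.
    rewrite dform_scaleE xj; case: eqVneq => [ji|_]; last first.
      by rewrite [ext_d _](ext_d0 M) scaler0.
    have xi : x = assoc_part j x by rewrite xj ji eqxx.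
    rewrite xi (kform_ext_d (@kform_part _ _ _ _ _)) ?scaler0//.
    by rewrite -addrA ji.
  by rewrite (form_part_kform _ K) eqxx.
Qed.

Lemma lk_map_vvform : is_vvform (E := E) 1 lk_map.
Proof.
apply: (@contraction_vvform 1 (fun k => (-1) ^+ (if odd k then k./2 else k./2.+1)) w).
  by rewrite -[n%:Z + 1]/((n + 1)%:Z) addn1; exact: nplectic_kform.
move=> s Y; rewrite /lk_map; case: ifP => // s1.
by rewrite to_assocE //; exact: lk_in.
Qed.

Lemma assoc_mu_vvform : (0 < n)%N -> is_vvform (E := E) 1 (@assoc_mu _ _ _ _ w).
Proof.
move=> /assoc_muE /funext ->.
exact: vvformD l1_map_vvform lk_map_vvform.
Qed.

Lemma assoc_mu_vanish x s : (0 < n)%N -> x \in s -> ham_vf x = 0 -> (1 < size s)%N ->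
  @assoc_mu _ _ _ _ w s = 0.
Proof.
move=> /assoc_muE -> xs hx s1.
have -> : l1_map s = 0 by move: s1; case: s {xs} => [|a [|]].
rewrite add0r; apply: assoc_ext => Y; rewrite /lk_map s1 to_assocE; last exact: lk_in.
by rewrite /lk_form (contract_ham0 _ xs hx) scaler0.
Qed.

(** The degree -1 part of l_1 x is exact, hence closed. *)
Lemma ham_vf_mu1 x : (0 < n)%N -> ham_vf (@assoc_mu _ _ _ _ w [:: x]) = 0.
Proof.
move=> /assoc_muE ->; rewrite /lk_map /= addr0.
apply: (hamiltonian_unique (ham_vfP _)).
rewrite /hamiltonian_for /= to_assocE; last exact: l1_in.
rewrite iprod0 oppr0 /l1_form; elim/big_ind: _ => [|a b ha hb|i _].
- by rewrite form_part0 ext_d0.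
- by rewrite form_partD ext_dD ha hb addr0.
rewrite form_partZ ext_dZ (form_part_kform _ (kform_ext_d (@kform_part _ _ _ _ _))).
by case: ifP => _; rewrite ?ext_d_d ?ext_d0 scaler0.
Qed.

(** * Pointwise limits *)

Lemma ptwise_cvg_unique (u : nat -> AE) x y : ptwise_cvg u x -> ptwise_cvg u y -> x = y.
Proof.
move=> ux uy; apply: assoc_ext => Y; apply: val_inj; apply/funext => p.
exact: (cvg_unique _ (ux Y p) (uy Y p)).
Qed.

Lemma ptwise_cvg_cst x : ptwise_cvg (fun=> x) x.
Proof. by move=> Y p; exact: cvg_cst. Qed.

Lemma ptwise_cvg_lin (u v : nat -> AE) (c : R) x y : ptwise_cvg u x -> ptwise_cvg v y ->
  ptwise_cvg (fun J => c *: u J + v J) (c *: x + y).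
Proof.
move=> ux vy Y p; exact: (cvgD (cvgM (cvg_cst c) (ux Y p)) (vy Y p)).
Qed.

Lemma ptwise_cvgZ (u : nat -> AE) (c : R) x : ptwise_cvg u x ->
  ptwise_cvg (fun J => c *: u J) (c *: x).
Proof.
move=> ux; have := @ptwise_cvg_lin _ _ c _ _ ux (@ptwise_cvg_cst 0); rewrite addr0.
by under eq_fun do rewrite addr0.
Qed.

Lemma ptwise_cvg_part (u : nat -> AE) i x : ptwise_cvg u x ->
  ptwise_cvg (fun J => assoc_part i (u J)) (assoc_part i x).
Proof.
move=> ux Y p; rewrite [assoc_val _ _]form_partE.
under eq_fun do rewrite [assoc_val _ _]form_partE.
by case: ifP => _; [exact: ux | exact: cvg_cst].
Qed.

(** Multilinearity, symmetry and homogeneity are equations between limits. *)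
Lemma vvform_lim d (u : nat -> seq AE -> AE) (K : seq AE -> AE) :
  (forall J, is_vvform (E := E) d (u J)) -> (forall s, ptwise_cvg (u^~ s) (K s)) ->
  is_vvform (E := E) d K.
Proof.
move=> hu uK; split.
- move=> s1 c x y s2; apply: (ptwise_cvg_unique (uK _)).
  have := @ptwise_cvg_lin _ _ c _ _ (uK (s1 ++ x :: s2)) (uK (s1 ++ y :: s2)).
  by congr ptwise_cvg; apply/funext => J; have [-> _ _] := hu J.
- move=> s1 i x j y s2 hx hy; apply: (ptwise_cvg_unique (uK _)).
  have := @ptwise_cvgZ _ ((-1) ^ (i * j)) _ (uK (s1 ++ y :: x :: s2)).
  by congr ptwise_cvg; apply/funext => J; have [_ /(_ s1 i x j y s2 hx hy) -> _] := hu J.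
- move=> t ht; apply: (ptwise_cvg_unique _ (uK _)).
  have := @ptwise_cvg_part _ (\sum_(v <- t) v.1 + d) _ (uK [seq v.2 | v <- t]).
  by congr ptwise_cvg; apply/funext => J; have [_ _ /(_ t ht)] := hu J.
Qed.

Lemma eta_tilde_vvform (eta : dform M) i : is_kform n%:Z eta -> (1 < i)%N ->
  is_vvform (E := E) 0 (eta_tilde eta i).
Proof.
move=> he i1.
apply: (@contraction_vvform 0 (fun k => (k == i)%:R) eta); first by rewrite addr0.
move=> s Y; rewrite /eta_tilde; case: (eqVneq (size s) i) => [si|_].
  by rewrite si i1 scale1r to_assocE//; apply: eta_in; rewrite // si.
by rewrite scale0r if_same.
Qed.

Definition tilde_sum (eta : nat -> dform M) (J : nat) (s : seq AE) : AE :=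
  \sum_(1 <= j < J) \sum_(2 <= i < n.+1) eta_tilde (eta j) i s.

(** * The sum of the contractions *)

Section Nijenhuis.
Hypothesis n_gt0 : (0 < n)%N.
Variables (eta : nat -> dform M) (H : seq AE -> AE).
Hypothesis eta_form : forall j, (1 <= j)%N -> is_kform n%:Z (eta j).
Hypothesis H_lim : forall s, ptwise_cvg (tilde_sum eta ^~ s) (H s).
Local Notation mu := (@assoc_mu _ _ _ _ w).

Lemma tilde_limit_ind (P : AE -> Prop) s :
  P 0 -> (forall x y, P x -> P y -> P (x + y)) ->
  (forall (u : nat -> AE) x, (forall J, P (u J)) -> ptwise_cvg u x -> P x) ->
  (forall j i, (1 <= j)%N -> (1 < i)%N -> P (eta_tilde (eta j) i s)) -> P (H s).
Proof.
move=> P0 PD Plim h; apply: (Plim (tilde_sum eta ^~ s)); last exact: H_lim.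
move=> J; rewrite /tilde_sum.
rewrite big_nat; elim/big_ind: _ => // j /andP[j1 _].
by rewrite big_nat; elim/big_ind: _ => // i /andP[i1 _]; apply: h.
Qed.

Lemma tilde_limit_vvform : is_vvform (E := E) 0 H.
Proof.
apply: vvform_lim H_lim => J; apply: vvform_sum => j; rewrite mem_index_iota.
move=> /andP[j1 _]; apply: vvform_sum => i; rewrite mem_index_iota => /andP[i1 _].
by apply: eta_tilde_vvform => //; exact: eta_form.
Qed.

Lemma tilde_limit_eq0 s :
  (forall j i, (1 <= j)%N -> (1 < i)%N -> eta_tilde (eta j) i s = 0 :> AE) -> H s = 0.
Proof.
move=> h; apply: (@tilde_limit_ind (fun x => x = 0)) => //.
- by move=> x y -> ->; rewrite addr0.
- move=> u x u0 ux; apply: (ptwise_cvg_unique ux).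
  by have := @ptwise_cvg_cst 0; congr ptwise_cvg; apply/funext => J; rewrite u0.
Qed.

(** The next two lemmas are the two halves of the nilpotency of H: it vanishes on
    the elements without Hamiltonian vector field, and takes its values there. *)
Lemma tilde_limit_vanish x s : x \in s -> ham_vf x = 0 -> H s = 0.
Proof.
move=> xs hx; apply: tilde_limit_eq0 => j i j1 i1.
rewrite /eta_tilde (contract_ham0 _ xs hx); case: ifP => // _.
by apply: assoc_ext => Y; rewrite to_assocE//; exact: in_assoc0.
Qed.

(** Contracting an n-form by at least two fields leaves a form of degree at most
    n - 2, while Hamiltonian vector fields come from the (n-1)-forms. *)
Lemma ham_vf_tilde_limit s : ham_vf (H s) = 0.
Proof.
apply: ham_vf_part0; apply: (@tilde_limit_ind (fun x => assoc_part (-1) x = 0)).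
- by apply: val_inj; exact: form_part0.
- by move=> x y hx hy; rewrite (gpartD (E := E) (-1) x y : assoc_part _ _ = _) /= hx hy addr0.
- move=> u x hu ux; apply: (ptwise_cvg_unique (@ptwise_cvg_part _ (-1) _ ux)).
  by have := @ptwise_cvg_cst 0; congr ptwise_cvg; apply/funext => J; rewrite hu.
move=> j i j1 i1; rewrite /eta_tilde; case: (eqVneq (size s) i) => si; last first.
  by apply: val_inj; exact: form_part0.
apply: val_inj => /=; rewrite to_assocE; last by apply: eta_in; rewrite ?si//; exact: eta_form.
rewrite (form_part_kform _ (kform_contract (eta_form j1))) size_map si ifF//.
by apply/eqP; lia.
Qed.

Lemma ham_vfD x y : ham_vf x = 0 -> ham_vf y = 0 -> ham_vf (x + y) = 0.
Proof. by move=> hx hy; rewrite -[x]scale1r ham_vf_lin hx hy scaler0 addr0. Qed.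

Lemma ham_vfZ c x : ham_vf x = 0 -> ham_vf (c *: x) = 0.
Proof. by move=> hx; rewrite -[c *: x]addr0 ham_vf_lin hx ham_vf0 scaler0 addr0. Qed.

Lemma ham_vf_vv_ins (K L : seq AE -> AE) s :
  (forall l r, ham_vf (L (K l :: r)) = 0) -> ham_vf (vv_ins (E := E) K L s) = 0.
Proof.
move=> h; apply: (@vv_ins_ind _ E (fun x => ham_vf x = 0)) => [||c|js l r _ _].
- exact: ham_vf0.
- exact: ham_vfD.
- exact: ham_vfZ.
- exact: h.
Qed.

Lemma vv_ins_eq0 (K L : seq AE -> AE) s :
  (forall l r, L (K l :: r) = 0) -> vv_ins (E := E) K L s = 0.
Proof.
move=> h; apply: (@vv_ins_ind _ E (fun x => x = 0)) => [||c x ->|js l r _ _] //.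
- by move=> x y -> ->; rewrite addr0.
- by rewrite scaler0.
- exact: h.
Qed.

(** If x has no Hamiltonian vector field, neither have its homogeneous
    components, one of which appears in each term of the insertion. *)
Lemma vv_ins_vanish (K L : seq AE -> AE) x s : x \in s -> ham_vf x = 0 ->
  (forall l r y, y \in l ++ r -> ham_vf y = 0 -> L (K l :: r) = 0) ->
  vv_ins (E := E) K L s = 0.
Proof.
move=> xs hx h; apply: (@vv_ins_ind _ E (fun x => x = 0)) => [||c y ->|js l r js_s lr] //.
- by move=> y z -> ->; rewrite addr0.
- by rewrite scaler0.
have [u ul hu] : exists2 u, u \in l ++ r & ham_vf (u.2 : AE) = 0.
  have x_i : (index x s < size s)%N by rewrite index_mem.
  exists (nth 0 js (index x s), assoc_part (nth 0 js (index x s)) x); last first.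
    exact: ham_vf_part.
  rewrite (perm_mem lr); apply/mapP; exists (nth 0 js (index x s), x) => //.
  by rewrite -[X in (_, X)](nth_index 0 xs) -nth_zip// mem_nth// size_zip js_s minnn.
by apply: (h _ _ u.2) => //; rewrite -map_cat map_f.
Qed.

(** With Q = [H, mu]: the values of Q have no Hamiltonian vector field
    ([ham_Hmu]), and Q vanishes when some argument has none ([Hmu_vanish]). Each
    of the two facts kills one half of [H, Q]. *)
Lemma double_rn_bracket_eq0 :
  rn_bracket (E := E) 0 1 H (rn_bracket (E := E) 0 1 H mu) =1 (fun=> 0).
Proof.
have HmuE s : rn_bracket (E := E) 0 1 H mu s = vv_ins (E := E) H mu s - vv_ins (E := E) mu H s.
  by rewrite /rn_bracket mul0r expr0z scale1r.
have ham_mu_H l r : ham_vf (mu (H l :: r)) = 0.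
  case: r => [|x r]; first exact: ham_vf_mu1.
  rewrite (assoc_mu_vanish n_gt0 (mem_head _ _) (ham_vf_tilde_limit l)) //.
  exact: ham_vf0.
have ham_Hmu s : ham_vf (rn_bracket (E := E) 0 1 H mu s) = 0.
  rewrite HmuE; apply: ham_vfD; first exact: ham_vf_vv_ins.
  rewrite -scaleN1r; apply/ham_vfZ/ham_vf_vv_ins => l r; exact: ham_vf_tilde_limit.
have Hmu_vanish x s : x \in s -> ham_vf x = 0 -> rn_bracket (E := E) 0 1 H mu s = 0.
  move=> xs hx; rewrite HmuE.
  have -> : vv_ins (E := E) H mu s = 0.
    apply: (vv_ins_vanish xs hx) => l r y; rewrite mem_cat => /orP[yl|yr] hy.
      have [mmu _ _] := assoc_mu_vvform n_gt0.
      by rewrite (tilde_limit_vanish yl hy); exact: (@multilin_head0 _ E _ r mmu).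
    apply: (assoc_mu_vanish n_gt0 _ hy); first by rewrite in_cons yr orbT.
    by case: r yr.
  have -> : vv_ins (E := E) mu H s = 0; last by rewrite subr0.
  apply: (vv_ins_vanish xs hx) => l r y; rewrite mem_cat => /orP[yl|yr] hy.
    apply: (tilde_limit_vanish (mem_head _ _)).
    case: l yl => [|z [|z' l]] // yl; first exact: ham_vf_mu1.
    by rewrite (assoc_mu_vanish n_gt0 yl hy)// ham_vf0.
  by apply: (tilde_limit_vanish _ hy); rewrite in_cons yr orbT.
move=> s; rewrite {1}/rn_bracket mul0r expr0z scale1r !vv_ins_eq0 ?subrr// => l r.
  exact/(tilde_limit_vanish (mem_head _ _))/ham_Hmu.
exact/(Hmu_vanish _ _ (mem_head _ _))/ham_vf_tilde_limit.
Qed.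

End Nijenhuis.

End Associated.

Theorem theorem2p5p14 (R : realType) (m : nat) (M : smoothManifold R m)
    (n : nat) (n_gt0 : (0 < n)%N) (w : nplectic M n)
    (eta : nat -> dform M)
    (eta_form : forall j : nat, (1 <= j)%N -> is_kform n%:Z (eta j))
    (N : seq (assocE w) -> assocE w)
    (N_sum : is_euler_plus_tildes eta N) :
  nijenhuis (E := assoc_graded w) (@assoc_mu _ _ _ _ w) N.
Proof.
pose S (s : seq (assocE w)) : assocE w := euler_map (E := assoc_graded w) s.
pose H s := (-1) *: S s + N s.
have H_lim s : ptwise_cvg (tilde_sum (w := w) eta ^~ s) (H s).
  have := ptwise_cvg_lin (c := -1) (@ptwise_cvg_cst _ _ _ _ w (S s)) (N_sum s).
  by congr ptwise_cvg; apply/funext => J; rewrite scaleN1r addKr.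
apply: (@euler_add_nijenhuis _ (assoc_graded w) _ H).
- exact: assoc_mu_vvform.
- exact: tilde_limit_vvform eta_form H_lim.
- by move=> s; exact: (double_rn_bracket_eq0 n_gt0 eta_form H_lim s).
- by move=> s; rewrite /H scaleN1r addNKr.
Qed.
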